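(* Let $n\ge 2$ and let $p\le q$ be positive integers with $p+q=n$. (i) Suppose $q\ge p\ge 1$. Then precisely the tree $D(p,q)$, which has $$2^{n-2}+2^{p-1}+2^{q-1}+n-2$$ subtrees, maximizes the total number of subtrees $F$ among all trees in $\mathscr{P}_n^{p,q}$; that is, $D(p,q)$ is, up to isomorphism, the unique maximizer. (ii) Suppose $q\ge p\ge 2$. Then precisely the tree $B(p,q)$, which has $$3\cdot 2^{n-4}+3\cdot 2^{q-2}+2^{p-2}+n-1 \ \text{ subtrees if } p>2,\quad\text{and}\quad 2^{n-2}+n+2 \ \text{ subtrees otherwise (i.e. if } p=2),$$ maximizes the total number of subtrees $F$ among all trees in $\mathscr{P}_n^{p,q}\setminus\{D(p,q)\}$; that is, $B(p,q)$ is, up to isomorphism, the unique maximizer. (iii) Precisely the tree $P_{2p-1}\left(\left\lfloor\frac{n-2p+1}{2}\right\rfloor,\left\lceil\frac{n-2p+1}{2}\right\rceil\right)$, which has $$(2p-1)\left(2^{\lfloor\frac{n-2p+1}{2}\rfloor}+2^{\lceil\frac{n-2p+1}{2}\rceil}\right)+\binom{n-2p+1}{2}+2^{n-2p+1}+n-2p+1$$ subtrees, minimizes the total number of subtrees $F$ among all trees in $\mathscr{P}_n^{p,q}$; that is, this tree is, up to isomorphism, the unique minimizer.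
   Context: All graphs are finite and simple. A subtree of a tree $T$ is a (nonempty) connected induced subgraph of $T$; $F(T)$ denotes the total number of subtrees of $T$ (with at least one vertex; subtrees are counted as distinct subgraphs, not up to isomorphism). A connected bipartite graph on $n$ vertices has a $(p,q)$-bipartition ($p\le q$, $p+q=n$) if its vertex set can be partitioned into $V_1,V_2$ with $|V_1|=p$, $|V_2|=q$ such that each edge joins a vertex of $V_1$ to a vertex of $V_2$. $\mathscr{P}_n^{p,q}$ is the class of all $n$-vertex trees having a $(p,q)$-bipartition. $K_{1,m}$ is the star with $m$ leaves and $P_m$ is the path on $m$ vertices. $D(p,q)$ (double star) is the tree obtained from the star $K_{1,p}$ by attaching $q-1$ pendant edges to a non-central vertex of $K_{1,p}$ (so it has $p+q$ vertices). For $q\ge p\ge 3$, $B(p,q)$ is the tree obtained from $D(p-1,q)$ by attaching a pendant edge to one of the degree-one vertices adjacent to the vertex of degree $q$ in $D(p-1,q)$. For $q\ge p=2$, $B(2,q)$ is the tree obtained from the path $P_4$ by attaching $q-2$ pendant edges to an end vertex of $P_4$. $P_m(a,b)$ is the tree obtained by attaching $a$ and $b$ pendant vertices to the two end vertices of $P_m$, respectively; in particular, for $m=1$, $P_1(a,b)=K_{1,a+b}$.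
   Formalization: In (iii) the printed count is false (K_2 has 3 subtrees, not 6); with k=n-2p+1 it is replaced by (2p-2)(2^⌊k/2⌋+2^⌈k/2⌉)+C(2p-2,2)+2^k+k. In (ii), for p=q=2 the class without D(2,2)=B(2,2)=P_4 is empty, so membership of B(p,q) in it is claimed only for (p,q)≠(2,2). *)

(* Defs.v *)
From mathcomp Require Import all_boot.
Set Implicit Arguments.
Unset Strict Implicit.
Unset Printing Implicit Defensive.

Record sgraph := SGraph {
  vert :> finType;
  adj : rel vert;
  adj_sym : symmetric adj;
  adj_irr : irreflexive adj
}.

Definition giso (G H : sgraph) : Prop :=
  exists f : G -> H, bijective f /\ forall x y, adj (f x) (f y) = adj x y.

(* A cycle is a duplicate-free cyclic sequence of length at least 3: an edge
   traversed back and forth is a ucycle of size 2. *)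
Definition is_tree (G : sgraph) : Prop :=
  [/\ 0 < #|G|,
      forall x y : G, connect (@adj G) x y
    & forall c : seq G, ucycle (@adj G) c -> size c < 3].

(* An induced subgraph is identified with its vertex set; the relation below is
   adjacency in the subgraph induced by A. *)
Definition connected_set (G : sgraph) (A : {set G}) : bool :=
  [forall x in A, forall y in A, connect [rel u v in A | adj u v] x y].

Definition subtrees (G : sgraph) : {set {set G}} :=
  [set A : {set G} | (A != set0) && connected_set A].

Definition F (G : sgraph) : nat := #|subtrees G|.

(* The classes of the bipartition are V1 and its complement. *)
Definition has_bipartition (p q : nat) (G : sgraph) : Prop :=
  exists V1 : {set G},
    [/\ #|V1| = p, #|~: V1| = q
      & forall x y : G, adj x y -> (x \in V1) != (y \in V1)].

Definition bip_tree (n p q : nat) (G : sgraph) : Prop :=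
  [/\ #|G| = n, is_tree G & has_bipartition p q G].

(* "Precisely G maximizes (minimizes) F over P", up to isomorphism; that G itself
   belongs to P is to be stated separately. *)
Definition precisely_maximizes (P : sgraph -> Prop) (G : sgraph) : Prop :=
  forall T, P T -> ((forall T', P T' -> F T' <= F T) <-> giso T G).

Definition precisely_minimizes (P : sgraph -> Prop) (G : sgraph) : Prop :=
  forall T, P T -> ((forall T', P T' -> F T <= F T') <-> giso T G).

(* Attaching k pendant edges to the vertex v of G: the new vertices are the
   [inr i], each adjacent to [inl v] only. *)
Definition attach_adj (G : sgraph) (v : G) (k : nat) : rel (G + 'I_k)%type :=
  fun x y =>
  match x, y with
  | inl a, inl b => adj a b
  | inl a, inr _ => a == v
  | inr _, inl b => b == v
  | inr _, inr _ => false
  end.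

Lemma attach_sym (G : sgraph) (v : G) k : symmetric (@attach_adj G v k).
Proof. by case=> [a|i] [b|j] //=; apply: adj_sym. Qed.

Lemma attach_irr (G : sgraph) (v : G) k : irreflexive (@attach_adj G v k).
Proof. by case=> [a|i] //=; apply: adj_irr. Qed.

Definition attach (G : sgraph) (v : G) (k : nat) : sgraph :=
  SGraph (@attach_sym G v k) (@attach_irr G v k).

(* K_{1,m}, with centre ord0. *)
Definition star_adj (m : nat) : rel 'I_m.+1 :=
  fun i j => (i == ord0) (+) (j == ord0).

Lemma star_sym m : symmetric (@star_adj m).
Proof. by move=> i j; apply: addbC. Qed.

Lemma star_irr m : irreflexive (@star_adj m).
Proof. by move=> i; apply: addbb. Qed.

Definition star (m : nat) : sgraph := SGraph (@star_sym m) (@star_irr m).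

(* P_m, with vertices 0 - 1 - ... - (m - 1). *)
Definition path_adj (m : nat) : rel 'I_m :=
  fun i j => (i.+1 == j :> nat) || (j.+1 == i :> nat).

Lemma path_sym m : symmetric (@path_adj m).
Proof. by move=> i j; apply: orbC. Qed.

Lemma path_irr m : irreflexive (@path_adj m).
Proof. by move=> i; rewrite /path_adj orbb gtn_eqF. Qed.

Definition path_graph (m : nat) : sgraph := SGraph (@path_sym m) (@path_irr m).

(* For p >= 1, ord_max is a non-central vertex of K_{1,p}. *)
Definition D (p q : nat) : sgraph := @attach (star p) ord_max q.-1.

(* For q >= p >= 3, the vertex of degree q in D(p-1,q) is [inl ord_max], and
   its neighbours of degree one are the q - 1 vertices [inr i]; the pendant edge
   is attached to the first of them.  The last branch is a junk value, reached
   only when p < 2 or q < 2. *)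
Definition B (p q : nat) : sgraph :=
  match p, q with
  | 2, _ => @attach (path_graph 4) ord0 (q - 2)
  | p'.+3, q'.+2 =>
      @attach (D p'.+2 q'.+2) (inr ord0 : 'I_p'.+3 + 'I_q'.+1)%type 1
  | _, _ => star 0
  end.

(* P_m(a,b); for m = 1 both groups of pendant vertices are attached to the same
   vertex.  The value for m = 0 is junk.  For m >= 2, sorting the subtrees by
   which of the two end vertices of P_m they contain gives
     F(P_m(a,b)) = 2^(a+b) + (m-1)(2^a + 2^b) + 'C(m-1,2) + a + b
   (both; exactly one; neither: a path inside P_m or a pendant vertex), and the
   formula also holds for m = 1.  For m = 2p-1 the coefficients are therefore
   2p-2 and 'C(2p-2,2); with 2p-1 and 'C(n-2p+1,2) in their place the count is
   wrong, e.g. 6 instead of 3 for P_1(0,1) = K_{1,1}. *)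
Definition Pab (m a b : nat) : sgraph :=
  match m with
  | 0 => star 0
  | m'.+1 => @attach (@attach (path_graph m'.+1) ord0 a)
                     (inl ord_max : 'I_m'.+1 + 'I_a)%type b
  end.

(* Main.v *)
Require Import Defs.
From mathcomp Require Import all_boot.
From mathcomp Require Import zify ring.

(** Everything is counted inside a fixed graph, for vertex sets S rather than for
    separate trees.  Write F(S) for the number of nonempty connected subsets of
    S, and f(S, u) for the number of those that contain u.  Cutting a tree S at
    an edge uv into parts C (containing u) and D (containing v) gives
      F(S) = F(C) + F(D) + f(C, u) f(D, v)   and   f(S, u) = f(C, u) (1 + f(D, v))
    ([bridge_wsub], [bridge_wsub_at]); both extremal problems rest on these two
    identities.

    Maximum.  Let the classes of S have sizes a and b, with u in the class of
    size a.  Induction along the second identity gives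
    f(S, u) <= 2^(b-1) (2^(a-1) + 1), with equality only if u is adjacent to the
    whole opposite class ([rooted_bound]).  The first identity then bounds F(S)
    by the count of the double star ([subtree_bound]).  For the second maximum
    the tree is cut at an edge uv none of whose ends is a leaf.  If u is alone in
    its class on its side, and v likewise, then both sides are stars and the tree
    is a double star.  Otherwise the same bounds, inserted into the first
    identity, give a strictly smaller value, and the cases of equality force the
    shape of B(p, q) or B(q, p) ([lopsided_bound], [double_star_or_lopsided]);
    for p <= q the former has at least as many subtrees.

    Minimum.  A tree whose classes have sizes p <= q has at least k = q - p + 1
    leaves in the larger class, because every other vertex y of that class leads
    away from a fixed root in the smaller class to a vertex of that class, and
    different y lead to different ones ([card_branching]).  Delete k such leaves
    and remember them as weights w on the remaining tree S, which has
    m = 2p - 1 vertices and total weight k; a connected set A then stands for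
    2^w(A) subtrees.  Contracting a pendant edge xv of S by moving the weight of
    x to v loses 2^w(x) for {x} and f(S - x, v) for the sets containing v but not
    x.  The latter is at least 2^(k-w(x)) + m - 2, as a growing chain of
    connected sets leads from {v} to S - x, and 2^i + 2^(k-i) is least when the
    split is balanced.  Hence, by induction on m ([min_bound]),
      2^k + (m-1) (2^floor(k/2) + 2^ceil(k/2)) + C(m-1, 2)
    bounds the weighted count from below, and F is larger by k, for the deleted
    leaves themselves.  Equality makes S a path with the
    weights at its two ends, as evenly as possible.

    All the extremal trees are caterpillars.  A caterpillar is determined up to
    isomorphism by the numbers of vertices hanging at the successive vertices of
    its spine ([caterpillar_giso]), and its subtrees are counted by a recursion
    on this list ([caterpillar_subtrees]). *)

Set Implicit Arguments.
Unset Strict Implicit.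
Unset Printing Implicit Defensive.

(** * Connected sets *)

Section Connectivity.
Variable G : sgraph.
Implicit Types (A B C D S : {set G}) (u v x y z : G) (w : G -> nat).

(** A cut criterion in place of walks: intersections and unions of connected
    sets are then treated by choosing the right cut. *)
Lemma connected_setP A :
  reflect (forall B, B \subset A -> B != set0 -> B != A ->
             exists x y, [/\ x \in B, y \in A :\: B & adj x y])
          (connected_set A).
Proof.
apply: (iffP idP) => [cA B sBA /set0Pn[x xB] neBA | cutA].
  have [y yA yB] : exists2 y, y \in A & y \notin B.
    by apply/subsetPn; move: neBA; rewrite eqEsubset sBA.
  have := forall_inP (forall_inP cA x (subsetP sBA x xB)) y yA.
  case/connectP=> p; elim: p x xB => [|z p IHp] x xB /=.
    by move=> _ eyx; rewrite eyx xB in yB.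
  case/andP=> /andP[/andP[xA zA] xz] pz eyz.
  case zB: (z \in B); first exact: (IHp z).
  by exists x, z; rewrite !inE zB zA.
apply/forall_inP => x xA; apply/forall_inP => y yA; apply/negPn/negP => nxy.
pose r := [rel u v in A | adj u v].
have [|||u [v []]] := cutA [set z in A | connect r x z].
- by apply/subsetP=> z; rewrite inE; case/andP.
- by apply/set0Pn; exists x; rewrite inE xA connect0.
- by apply: contraNneq nxy => eB; move: yA; rewrite -{1}eB inE => /andP[].
rewrite !inE => /andP[uA xu] /andP[nv vA] uv.
case/negP: nv; rewrite vA /=; apply: connect_trans xu _.
by apply: connect1; rewrite /= uA vA.
Qed.

Lemma connected_set1 x : connected_set [set x].
Proof.
apply/connected_setP=> B; rewrite subset1 => /orP[/eqP-> _|/eqP->].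
  by rewrite eqxx.
by rewrite eqxx.
Qed.

Lemma connected_setU A B x y :
  connected_set A -> connected_set B -> x \in A -> y \in B -> adj x y ->
  connected_set (A :|: B).
Proof.
move=> cA cB xA yB xy; apply/connected_setP=> E sE nE0 neE.
have cut X : connected_set X -> X \subset A :|: B -> E :&: X != set0 ->
    ~~ (X \subset E) ->
    exists x y, [/\ x \in E, y \in (A :|: B) :\: E & adj x y].
  move=> cX sX nX0 nXE.
  have [|||a [b []]] := connected_setP X cX (E :&: X) => //.
  - exact: subsetIr.
  - by apply: contra nXE => /eqP <-; apply: subsetIl.
  rewrite !inE => /andP[aE aX] /andP[nb bX] ab; exists a, b; split=> //.
  move: nb; rewrite bX andbT => nb; rewrite inE nb.
  by move/subsetP: sX; apply.
have [AE|nAE] := boolP (A \subset E); last first.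
  have [E0|] := eqVneq (E :&: A) set0; last first.
    by move=> EA; apply: cut (subsetUl _ _) EA nAE.
  have EB0 : E :&: B != set0.
    apply: contraNneq nE0 => EB0; rewrite -subset0 -(setIidPl sE) setIUr E0 EB0.
    by rewrite setU0.
  have [BE|nBE] := boolP (B \subset E); last exact: cut (subsetUr _ _) EB0 nBE.
  exists y, x; rewrite (subsetP BE) // adj_sym xy !inE xA /=.
  rewrite andbT; split=> //; apply/negP=> xE.
  by move/setP/(_ x): E0; rewrite !inE xA xE.
have [BE|nBE] := boolP (B \subset E).
  by case/eqP: neE; apply/eqP; rewrite eqEsubset sE subUset AE.
have [E0|] := eqVneq (E :&: B) set0; last first.
  by move=> EB; apply: cut (subsetUr _ _) EB nBE.
exists x, y; rewrite (subsetP AE) // !inE yB orbT andbT; split=> //.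
by apply/negP=> yE; move/setP/(_ y): E0; rewrite !inE yB yE.
Qed.

Lemma tree_connected_setT : is_tree G -> connected_set [set: G].
Proof.
move=> [_ /[swap] _ ] cxy; apply/forall_inP=> x _; apply/forall_inP=> y _.
by rewrite (eq_connect (e' := @adj G)) // => a b; rewrite /= !inE.
Qed.

(** Acyclicity of trees is used through this lemma alone: a path inside C between
    two neighbours of v would close up to a cycle through v. *)
Lemma tree_adj1 C v x y : is_tree G -> connected_set C -> v \notin C ->
  x \in C -> y \in C -> adj v x -> adj v y -> x = y.
Proof.
case=> _ _ acy cC vC xC yC vx vy; apply/eqP/negPn/negP=> nexy.
have := forall_inP (forall_inP cC x xC) y yC.
case/connectP=> p0 /shortenP[p pp up _] ey.
have [padj pC] : path (@adj G) x p /\ all (mem C) (x :: p).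
  elim: p {up ey vx nexy} x xC pp => [|z p IHp] x xC /=; first by rewrite xC.
  case/andP=> /andP[/andP[_ zC] xz] /(IHp z zC)[pz az].
  by rewrite xz pz xC.
have /acy : ucycle (@adj G) [:: v, x & p].
  rewrite /ucycle /= vx rcons_path padj -ey adj_sym vy /= -/(uniq (x :: p)).
  have -> : uniq (x :: p) by [].
  by rewrite andbT; apply: contra vC => /(allP pC).
by case: p ey {pp up padj pC} => //= eyx; rewrite eyx eqxx in nexy.
Qed.

(** Neither C nor D has to be connected: the same notion serves for cutting a tree
    at an edge and for hanging one more vertex on an arbitrary set. *)
Definition bridge C D u v :=
  [/\ [disjoint C & D], u \in C, v \in D, adj u v
    & forall x y, x \in C -> y \in D -> adj x y -> x = u /\ y = v].

Lemma bridge_sym C D u v : bridge C D u v -> bridge D C v u.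
Proof.
case=> dCD uC vD uv b; split; rewrite 1?disjoint_sym 1?adj_sym // => x y xD yC.
by rewrite adj_sym => /(b _ _ yC xD)[].
Qed.

(** A cut of A :&: C that avoids u is already a cut of A; one that contains u
    becomes a cut of A once A :&: D is added to it.  In both cases the bridge does
    not cross the cut, so the crossing edge lies inside C. *)
Lemma bridge_connectedI C D u v A : bridge C D u v -> connected_set A ->
  A \subset C :|: D -> connected_set (A :&: C).
Proof.
case=> dCD uC vD uv br cA sA; apply/connected_setP=> B sB nB0 nBA.
have AP x : x \in A -> (x \in C) + (x \in D).
  by move/(subsetP sA); rewrite inE; case: (x \in C) => [|/=]; [left|right].
have sBA : B \subset A by apply: subset_trans sB (subsetIl _ _).
have sBC : B \subset C by apply: subset_trans sB (subsetIr _ _).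
have [uB|uB] := boolP (u \in B); last first.
  have [|||x [y [xB]]] := connected_setP A cA B => //.
    by apply: contraNneq nBA => eBA; rewrite eqEsubset sB eBA subsetIl.
  rewrite inE => /andP[yB yA] xy; exists x, y; rewrite !inE yB yA; split=> //.
  have [//|yD] := AP y yA; have [ex _] := br x y (subsetP sBC x xB) yD xy.
  by rewrite -ex xB in uB.
have [|||x [y []]] := connected_setP A cA (B :|: A :&: D) => //.
- by rewrite subUset sBA subsetIl.
- by apply/set0Pn; exists u; rewrite inE uB.
- apply: contraNneq nBA => eA; rewrite eqEsubset sB /=; apply/subsetP=> z.
  rewrite inE -{1}eA !inE => /andP[/orP[//|/andP[_ zD]] zC].
  by case/negP: (disjointFr dCD zC).
rewrite !inE negb_or => xBD /andP[/andP[yB nyD] yA] xy.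
have yC : y \in C by case: (AP y yA) => // yD; rewrite yA yD in nyD.
case/orP: xBD => [xB|/andP[xA xD]]; first by exists x, y; rewrite !inE yB yA yC.
by rewrite adj_sym in xy; have [ey _] := br y x yC xD xy; rewrite ey uB in yB.
Qed.

End Connectivity.

(** * Cutting along a bridge *)

Section Bridges.
Variable G : sgraph.
Implicit Types (A B C D S : {set G}) (u v x y z : G) (w : G -> nat).

Lemma bridge_connected C D u v :
  bridge C D u v -> connected_set (C :|: D) -> connected_set C.
Proof.
move=> br cCD; have := bridge_connectedI br cCD (subxx _).
by rewrite (setIidPr (subsetUl C D)).
Qed.

(** C is a maximal connected subset of S :\ v that contains u.  By maximality its
    only neighbour in S outside C is v, and [tree_adj1] leaves u as the only
    vertex of C adjacent to v. *)
Lemma tree_bridge S u v : is_tree G -> connected_set S -> u \in S -> v \in S ->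
  adj u v ->
  exists C D, [/\ S = C :|: D, bridge C D u v, connected_set C & connected_set D].
Proof.
move=> tG cS uS vS uv.
pose P C := [&& u \in C, C \subset S :\ v & connected_set C].
have neuv : u != v by apply: contraTneq uv => ->; rewrite adj_irr.
have P1 : P [set u].
  by rewrite /P inE eqxx connected_set1 sub1set !inE uS neuv.
have [C /maxsetP[/and3P[uC sC cC] maxC] _] := maxset_exists P1.
have vC : v \notin C by apply/negP=> /(subsetP sC); rewrite !inE eqxx.
have sCS : C \subset S by apply: subset_trans sC (subD1set _ _).
have eS : S = C :|: S :\: C by rewrite setDE setUIr setUCr setIT (setUidPr sCS).
have br : bridge C (S :\: C) u v.
  split=> //; rewrite ?inE ?vC //.
    by rewrite -setI_eq0 setIDA setIC setDE -setIA setICr setI0.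
  move=> x y xC; rewrite inE => /andP[yC yS] xy.
  have eyv : y = v.
    apply/eqP/negPn/negP=> neyv; case/negP: yC.
    suff <- : y |: C = C by rewrite !inE eqxx.
    apply: maxC; last exact: subsetUr.
    rewrite /P inE uC orbT subUset sC sub1set !inE neyv yS /=.
    rewrite adj_sym in xy.
    by apply: connected_setU xC xy; rewrite ?connected_set1 ?inE.
  split=> //; apply: (tree_adj1 tG cC vC xC uC); rewrite adj_sym ?uv //.
  by rewrite -eyv.
exists C, (S :\: C); split=> //; apply: (bridge_connected (bridge_sym br)).
by rewrite setUC -eS.
Qed.

Definition wt w A := \sum_(x in A) w x.

(** The weight w x stands for w x deleted pendant vertices of x: a connected set A
    can be completed by any of the pendant vertices at its elements.  The zero
    weight gives the plain count. *)
Definition wsub w S := \sum_(A in subtrees G | A \subset S) 2 ^ wt w A.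

Definition wsub_at w S v :=
  \sum_(A in subtrees G | (A \subset S) && (v \in A)) 2 ^ wt w A.

Lemma F_wsub : F G = wsub (fun=> 0) [set: G].
Proof.
rewrite /F /wsub -sum1_card; apply: eq_big => A; first by rewrite subsetT andbT.
by rewrite /wt big1.
Qed.

Lemma wtU w A B : [disjoint A & B] -> wt w (A :|: B) = wt w A + wt w B.
Proof.
move=> dAB; rewrite /wt -bigU /=; last exact: dAB.
by apply: eq_bigl => x; rewrite inE.
Qed.

Lemma in_subtrees v A : v \in A -> (A \in subtrees G) = connected_set A.
Proof. by move=> vA; rewrite inE; have /set0Pn-> : exists x, x \in A by exists v. Qed.

Lemma bridge_ends C D u v A : bridge C D u v -> connected_set A ->
  A \subset C :|: D -> ~~ (A \subset C) -> ~~ (A \subset D) ->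
  (u \in A) && (v \in A).
Proof.
case=> dCD uC vD uv br cA sA nC nD.
have [|||x [y []]] := connected_setP A cA (A :&: C).
- exact: subsetIl.
- apply: contraNneq nD => A0; apply/subsetP=> x xA.
  have := subsetP sA x xA; rewrite inE => /orP[xC|//].
  by move/setP/(_ x): A0; rewrite !inE xA xC.
- by apply: contra nC => /eqP<-; apply: subsetIr.
rewrite !inE => /andP[xA xC] /andP[nyA yA] xy; rewrite yA /= in nyA.
have := subsetP sA y yA; rewrite inE (negPf nyA) /= => yD.
by have [<- <-] := br x y xC yD xy; rewrite xA yA.
Qed.

(** The connected sets that contain both ends are the unions of a connected subset
    of C through u and a connected subset of D through v. *)
Lemma bridge_both w C D u v : bridge C D u v ->
  \sum_(A in subtrees G | (A \subset C :|: D) && ((u \in A) && (v \in A)))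
     2 ^ wt w A = wsub_at w C u * wsub_at w D v.
Proof.
move=> br; have [dCD uC vD uv _] := br.
rewrite /wsub_at big_distrlr /= pair_big_dep /=.
pose h (X : {set G} * {set G}) := X.1 :|: X.2.
pose h' A := (A :&: C, A :&: D).
have hK (X : {set G} * {set G}) : X.1 \subset C -> X.2 \subset D -> h' (h X) = X.
  case: X => X Y /= sX sY; rewrite /h' /h /= !setIUl.
  rewrite (setIidPl sX) (setIidPl sY).
  have -> : Y :&: C = set0.
    by apply/eqP; rewrite setI_eq0 disjoint_sym (disjointWr sY).
  have -> : X :&: D = set0 by apply/eqP; rewrite setI_eq0 (disjointWl sX).
  by rewrite setU0 set0U.
rewrite (reindex_onto h h'); last first.
  by move=> A /andP[_ /andP[sA _]]; rewrite /h /h' /= -setIUr (setIidPl sA).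
apply: eq_big => [[X Y] /=|[X Y]]; last first.
  case/andP=> _ /eqP eXY; rewrite -expnD -wtU //=.
  move: eXY; rewrite /h' /h /= => -[<- <-].
  by apply: disjointW dCD; apply: subsetIr.
apply/idP/idP => [/andP[]|].
  rewrite /h /= => /andP[tA /andP[sA /andP[uA vA]]] /eqP eXY.
  have cA : connected_set (X :|: Y) by rewrite -(in_subtrees uA).
  have [eX eY] : (X :|: Y) :&: C = X /\ (X :|: Y) :&: D = Y by case: eXY.
  have uX : u \in X by rewrite -eX inE uA.
  have vY : v \in Y by rewrite -eY inE vA.
  have cX : connected_set X by rewrite -eX (bridge_connectedI br).
  have cY : connected_set Y.
    by rewrite -eY (bridge_connectedI (bridge_sym br)) // (setUC D).
  have sX : X \subset C by rewrite -eX subsetIr.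
  have sY : Y \subset D by rewrite -eY subsetIr.
  by rewrite (in_subtrees uX) (in_subtrees vY) uX vY sX sY cX cY.
case/andP=> /andP[tX /andP[sX uX]] /andP[tY /andP[sY vY]].
rewrite hK // eqxx andbT /h /= (in_subtrees (v := u)) ?inE ?uX ?vY ?orbT //=.
rewrite setUSS // andbT.
rewrite (in_subtrees uX) in tX; rewrite (in_subtrees vY) in tY.
rewrite andbT; exact: connected_setU tX tY uX vY uv.
Qed.

Lemma bridge_wsub w C D u v : bridge C D u v ->
  wsub w (C :|: D) = wsub w C + wsub w D + wsub_at w C u * wsub_at w D v.
Proof.
move=> br; have [dCD uC vD uv _] := br.
rewrite -(bridge_both w br) /wsub (bigID (fun A => A \subset C)) /= -addnA.
congr (_ + _).
  apply: eq_bigl => A; rewrite -andbA; congr (_ && _).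
  by have [sC|] := boolP (A \subset C); rewrite ?andbF // (subset_trans sC) ?subsetUl.
rewrite (bigID (fun A => A \subset D)) /=; congr (_ + _); apply: eq_bigl => A.
  rewrite -!andbA; have [tA|//] := boolP (A \in _) => /=.
  have [sD|nD] := boolP (A \subset D); rewrite ?andbF // andbT.
  rewrite (subset_trans sD) ?subsetUr //=; apply/negP=> sC.
  move: tA; rewrite inE => /andP[/set0Pn[x xA] _].
  by have := subsetP sD x xA; rewrite (disjointFr dCD (subsetP sC x xA)).
rewrite -!andbA; have [tA|//] := boolP (A \in _) => /=.
have [sA|//] := boolP (A \subset _) => /=.
apply/andP/andP=> [[nC nD]|[uA vA]].
  apply/andP; apply: (bridge_ends br) => //.
  by move: tA; rewrite inE => /andP[].
split; apply/negP=> /subsetP sX.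
  by have := sX v vA; rewrite (disjointFl dCD vD).
by have := sX u uA; rewrite (disjointFr dCD uC).
Qed.

Lemma bridge_wsub_at w C D u v : bridge C D u v ->
  wsub_at w (C :|: D) u = wsub_at w C u * (1 + wsub_at w D v).
Proof.
move=> br; have [dCD uC vD uv _] := br.
rewrite mulnDr muln1 -(bridge_both w br) /wsub_at.
rewrite (bigID (fun A => v \in A)) /= addnC; congr (_ + _); apply: eq_bigl => A.
  rewrite -!andbA; have [tA|//] := boolP (A \in _) => /=.
  apply/idP/idP => [/and3P[sA uA vA]|/andP[sC uA]].
    rewrite uA andbT; apply: contraR vA => nC.
    have nD : ~~ (A \subset D).
      by apply/negP=> /subsetP/(_ u uA); rewrite (disjointFr dCD uC).
    have cA : connected_set A by move: tA; rewrite inE => /andP[].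
    by have /andP[] := bridge_ends br cA sA nC nD.
  rewrite uA (subset_trans sC) ?subsetUl //=; apply/negP=> /(subsetP sC) vC.
  by rewrite (disjointFr dCD vC) in vD.
by rewrite -!andbA.
Qed.

Lemma wsub_at1 w u : wsub_at w [set u] u = 2 ^ w u.
Proof.
rewrite /wsub_at (bigD1 [set u]) /=; last first.
  by rewrite (in_subtrees (v := u)) inE ?subxx ?eqxx ?connected_set1.
rewrite big1 ?addn0 /wt ?big_set1 // => A /andP[/andP[_ /andP[]]].
by rewrite subset1 => /orP[->//|/eqP->]; rewrite inE.
Qed.

Lemma wsub_set1 w u : wsub w [set u] = 2 ^ w u.
Proof.
rewrite -(wsub_at1 w u); apply: eq_bigl => A; rewrite subset1.
have [->|_] /= := eqVneq A [set u]; first by rewrite inE eqxx.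
by have [->|] := eqVneq A set0; rewrite ?andbF // !inE eqxx.
Qed.

End Bridges.

(** * Weights and pendant vertices *)

Section Weights.
Variable G : sgraph.
Implicit Types (A B C D S L : {set G}) (u v x y z : G) (w : G -> nat) (s : seq G).

Lemma eq_wsub w1 w2 S : {in S, w1 =1 w2} -> wsub w1 S = wsub w2 S.
Proof.
move=> ew; apply: eq_bigr => A /andP[_ sA]; congr (2 ^ _).
by apply: eq_bigr => x /(subsetP sA); apply: ew.
Qed.

Definition add_wt v k w x := w x + (x == v) * k.

Lemma wt_add v k w A : wt (add_wt v k w) A = wt w A + (v \in A) * k.
Proof.
rewrite /wt big_split /=; congr (_ + _); have [vA|vA] := boolP (v \in A).
  by rewrite (bigD1 v) //= eqxx big1 ?addn0 // => x /andP[_ /negPf->].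
by rewrite big1 // => x xA; rewrite (_ : x == v = false) //; apply: contraNF vA => /eqP<-.
Qed.

Lemma wsub_split w S v : wsub w S = wsub_at w S v +
  \sum_(A in subtrees G | (A \subset S) && (v \notin A)) 2 ^ wt w A.
Proof.
by rewrite /wsub (bigID (fun A => v \in A)) /=; congr (_ + _);
  apply: eq_bigl => A; rewrite -andbA.
Qed.

Lemma wsub_at_add w S v k : wsub_at (add_wt v k w) S v = 2 ^ k * wsub_at w S v.
Proof.
rewrite /wsub_at big_distrr /=; apply: eq_bigr => A /andP[_ /andP[_ vA]].
by rewrite wt_add vA mul1n expnD mulnC.
Qed.

Lemma wsub_add w S v k :
  wsub (add_wt v k w) S + wsub_at w S v = wsub w S + 2 ^ k * wsub_at w S v.
Proof.
rewrite !(wsub_split _ S v) wsub_at_add addnAC [RHS]addnC addnA; congr (_ + _).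
apply: eq_bigr => A /andP[_ /andP[_ /negPf vA]].
by rewrite wt_add vA addn0.
Qed.

Definition pend S y := #|[set x | (x \notin S) && adj x y]|.

(** Deleting one pendant vertex x at y loses the set {x}, and halves the number of
    connected sets through y; raising the weight of y by one makes up for the
    latter. *)
Lemma wsub_pendants L S w : [disjoint L & S] -> {in L, w =1 fun=> 0} ->
  {in L, forall x, exists2 y, y \in S & forall z, adj x z = (z == y)} ->
  wsub w (L :|: S) = #|L| + wsub (fun y => w y + #|[set x in L | adj x y]|) S.
Proof.
have [n] := ubnP #|L|; elim: n => // n IHn in L w *.
rewrite ltnS => leL dLS w0 pL; have [L0|[x xL]] := set_0Vmem L.
  rewrite L0 set0U cards0; apply: eq_wsub => y _.
  by rewrite (_ : [set x in set0 | _] = set0) ?cards0 ?addn0 //; apply/setP=> z; rewrite !inE.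
have [y yS axy] := pL x xL; pose L' := L :\ x.
have eL : L :|: S = [set x] :|: (L' :|: S) by rewrite setUA setD1K.
have xS : x \notin S by rewrite (disjointFr dLS xL).
have br : bridge [set x] (L' :|: S) x y.
  split; rewrite ?inE ?eqxx ?yS ?orbT ?axy //.
    by rewrite disjoints1 !inE eqxx.
  by move=> a b; rewrite inE => /eqP-> _; rewrite axy => /eqP->.
have lt : #|L'| < #|L| by rewrite [X in _ < X](cardsD1 x) xL add1n.
have yL : y \notin L by rewrite (disjointFl dLS yS).
rewrite eL (bridge_wsub _ br) wsub_set1 wsub_at1 w0 // mul1n -addnA.
have -> : wsub w (L' :|: S) + wsub_at w (L' :|: S) y = wsub (add_wt y 1 w) (L' :|: S).
  by apply/eqP; rewrite -(eqn_add2r (wsub_at w (L' :|: S) y)) wsub_add mul2n -addnn addnA.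
rewrite IHn; first last.
- by move=> z /setD1P[_ zL]; apply: pL.
- move=> z /setD1P[_ zL]; rewrite /add_wt w0 // (_ : z == y = false) //.
  by apply: contraNF yL => /eqP<-.
- by apply: disjointWl dLS; apply: subD1set.
- exact: leq_trans lt leL.
rewrite addnA [X in _ = X + _](cardsD1 x) xL; congr (_ + _); apply: eq_wsub => z zS.
rewrite /add_wt muln1 -addnA; congr (_ + _).
rewrite [RHS](cardsD1 x) inE xL axy; congr (_ + _); apply: eq_card => a.
by rewrite !inE andbA.
Qed.

Lemma F_pendants S :
  (forall x, x \notin S -> exists2 y, y \in S & forall z, adj x z = (z == y)) ->
  F G = #|~: S| + wsub (pend S) S.
Proof.
move=> pS; rewrite F_wsub -(setUCr S) setUC wsub_pendants.
- congr (_ + _); apply: eq_wsub => y _; congr #|pred_of_set _|.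
  by apply/setP=> x; rewrite !inE.
- by rewrite disjoint_sym disjoints_subset setCK.
- by [].
- by move=> x; rewrite inE; apply: pS.
Qed.

(** Contraction of the edge xv.  After the move of the weight of x to v, the sets
    through v account for those containing both x and v; what is lost is {x} and
    the sets containing v but not x. *)
Lemma wsub_push w S x v : bridge [set x] S x v ->
  wsub w (x |: S) = wsub (add_wt v (w x) w) S + 2 ^ w x + wsub_at w S v.
Proof.
move=> br; rewrite (bridge_wsub _ br) wsub_set1 wsub_at1 -addnA -wsub_add.
by rewrite addnCA addnA.
Qed.

Definition induced_path s := uniq s /\ {in s &, forall x y, adj x y =
   ((index x s).+1 == index y s) || ((index y s).+1 == index x s)}.

(** For a path whose vertices carry the weights ws, [prefix_sum] is the weighted
    count of the intervals that start at its first vertex, and [infix_sum] that of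
    all nonempty intervals; see [wsub_path]. *)
Fixpoint prefix_sum (ws : seq nat) :=
  if ws is a :: ws' then 2 ^ a * (1 + prefix_sum ws') else 0.

Fixpoint infix_sum (ws : seq nat) :=
  if ws is a :: ws' then prefix_sum ws + infix_sum ws' else 0.

Lemma induced_path_tail x s : induced_path (x :: s) -> induced_path s.
Proof.
case=> /= /andP[xs us] adjs; split=> // y z ys zs.
have ne a : a \in s -> (x == a) = false.
  by move=> sa; apply: contraNF xs => /eqP->.
by rewrite adjs ?inE ?ys ?zs ?orbT //= !ne // !eqSS.
Qed.

Lemma induced_path_bridge x v s : induced_path [:: x, v & s] ->
  bridge [set x] [set y in v :: s] x v.
Proof.
move=> [us adjs]; have /= /andP[xs _] := us; move: (xs); rewrite inE negb_or => /andP[xv xs'].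
split; rewrite ?disjoints1 ?inE ?eqxx ?negb_or ?xv ?xs' //.
  by rewrite adjs ?inE ?eqxx ?orbT //= ?eqxx (negPf xv) /= ?eqxx.
move=> a y; rewrite !inE => /eqP-> ys; rewrite adjs ?inE ?eqxx ?ys ?orbT //=.
rewrite eqxx; case: (x == y) => //=; case: (eqVneq v y) => [->//|nvy].
by rewrite orbF.
Qed.

Lemma wsub_path w s : induced_path s ->
  wsub w [set x in s] = infix_sum (map w s) /\
  (forall x s', s = x :: s' -> wsub_at w [set x in s] x = prefix_sum (map w s)).
Proof.
elim: s => [_|x s]; last case: s => [_ _|v s IHs].
- split=> //; rewrite /wsub big1 // => A /andP[]; rewrite inE => /andP[/set0Pn[x xA] _].
  by move/subsetP/(_ x xA); rewrite inE.
- have -> : [set y in [:: x]] = [set x] by apply/setP=> y; rewrite !inE.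
  by split=> [|_ _ [<- _]] /=; rewrite ?wsub_set1 ?wsub_at1; lia.
move=> ips; have [IH1 IH2] := IHs (induced_path_tail ips).
have br := induced_path_bridge ips.
have -> : [set y in [:: x, v & s]] = [set x] :|: [set y in v :: s].
  by apply/setP=> y; rewrite !inE.
have {}IH2 := IH2 v s erefl.
split=> [|_ _ [<- _]].
  by rewrite (bridge_wsub _ br) wsub_set1 wsub_at1 IH1 IH2 /=; lia.
by rewrite (bridge_wsub_at _ br) wsub_at1 IH2.
Qed.

End Weights.

(** * Caterpillars *)

(** Two graphs whose adjacency depends only on labels are isomorphic as soon as
    each label is used equally often: any bijections between the classes of
    equally labelled vertices fit together. *)
Lemma giso_labels (G H : sgraph) (L : eqType) (g : G -> L) (h : H -> L)
    (R : rel L) (x0 : G) (y0 : H) :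
  (forall x y, adj x y = R (g x) (g y)) ->
  (forall x y, adj x y = R (h x) (h y)) ->
  (forall l, #|[set x | g x == l]| = #|[set y | h y == l]|) ->
  giso G H.
Proof.
have transport (X Y : finType) (a : X -> L) (b : Y -> L) (d : Y) :
    (forall l, #|[set x | a x == l]| = #|[set y | b y == l]|) ->
    exists f : X -> Y, injective f /\ forall x, b (f x) = a x.
  move=> eqc; pose E l := enum [set x | a x == l]; pose E' l := enum [set y | b y == l].
  have inE' x : x \in E (a x) by rewrite mem_enum inE.
  have sz l : size (E l) = size (E' l) by rewrite -!cardE eqc.
  have ix x : index x (E (a x)) < size (E' (a x)) by rewrite -sz index_mem.
  pose f x := nth d (E' (a x)) (index x (E (a x))).
  have bf x : b (f x) = a x.
    by have := mem_nth d (ix x); rewrite -/(f x) mem_enum inE => /eqP.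
  exists f; split=> // x y efxy; have eaxy : a x = a y by rewrite -!bf efxy.
  move: efxy => /eqP; rewrite /f eaxy nth_uniq ?enum_uniq //; last first.
    by rewrite -{1}eaxy -sz eaxy index_mem -eaxy.
  by move=> /eqP e; rewrite -[x](nth_index x (inE' x)) eaxy e nth_index.
move=> aG aH eqc; have [f [injf hf]] := transport G H g h y0 eqc.
have [f' [injf' _]] := transport H G h g x0 (fun l => esym (eqc l)).
exists f; split; last by move=> x y; rewrite aG aH !hf.
by apply: inj_card_bij => //; apply: leq_card injf'.
Qed.

Section Caterpillar.
Variables (G : sgraph) (s : seq G).
Implicit Types (x y z : G).

Definition pendant_outside := forall x, x \notin s ->
  exists2 y, y \in s & forall z, adj x z = (z == y).

Hypotheses (ips : induced_path s) (pds : pendant_outside).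
Let S := [set x in s].

(** A spine vertex is labelled by its position, a vertex outside the spine by the
    position of its unique neighbour. *)
Definition label x := if x \in s then (true, index x s) else (false, find (adj x) s).

Definition label_adj (l1 l2 : bool * nat) :=
  match l1, l2 with
  | (true, i), (true, j) => (i.+1 == j) || (j.+1 == i)
  | (false, _), (false, _) => false
  | (_, i), (_, j) => i == j
  end.

Lemma find_pendant x y : (forall z, adj x z = (z == y)) -> find (adj x) s = index y s.
Proof. by move=> e; apply: eq_find => z; rewrite e. Qed.

Lemma labelP x y : adj x y = label_adj (label x) (label y).
Proof.
have inj a b : a \in s -> (index a s == index b s) = (a == b).
  move=> sa; apply/eqP/eqP=> [e|->//].
  by apply: (index_inj a sa _ e); rewrite -index_mem -e index_mem.
rewrite /label; case: ifPn => xs; case: ifPn => ys /=.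
- by case: ips => _; apply.
- by have [z zs e] := pds ys; rewrite (find_pendant e) adj_sym e inj.
- by have [z zs e] := pds xs; rewrite (find_pendant e) e inj // eq_sym.
have [z zs e] := pds xs; rewrite e; apply: contraNF ys => /eqP->; exact: zs.
Qed.

Lemma label_lt x : (label x).2 < size s.
Proof.
rewrite /label; case: ifPn => xs /=; first by rewrite index_mem.
by have [z zs e] := pds xs; rewrite (find_pendant e) index_mem.
Qed.

Lemma card_label b i : #|[set x | label x == (b, i)]| =
  if b then (i < size s : nat) else nth 0 [seq pend S y | y <- s] i.
Proof.
have us : uniq s by case: ips.
have [lti|lei] := ltnP i (size s); last first.
  rewrite (_ : [set x | _] = set0) ?cards0.
    by case: b; rewrite ?nth_default ?size_map.
  apply/setP=> x; rewrite !inE; apply/eqP=> e.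
  by have := label_lt x; rewrite e /= ltnNge lei.
have /hasP[x0 _ _] : has predT s by rewrite has_predT; case: (size s) lti.
case: b.
  rewrite (_ : [set x | _] = [set nth x0 s i]) ?cards1 //.
  apply/setP=> x; rewrite !inE /label; case: ifPn => xs.
    by rewrite xpair_eqE eqxx -(nth_uniq x0 _ lti us) ?nth_index ?index_mem.
  by rewrite xpair_eqE /=; apply/esym; apply: contraNF xs => /eqP->; rewrite mem_nth.
rewrite (nth_map x0) // /pend; apply: eq_card => x; rewrite !inE /label.
case: ifPn => xs; rewrite xpair_eqE //=.
have [z zs e] := pds xs; rewrite (find_pendant e) e.
by rewrite -[X in _ = (_ == X)](nth_index x0 zs) nth_uniq ?index_mem // eq_sym.
Qed.

(** Summing a function of the label position by position; with indicator functions
    this gives the order of the graph and the sizes of its colour classes. *)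
Lemma sum_label (P : bool * nat -> nat) : \sum_x P (label x) =
  \sum_(i < size s) (P (true, val i) + P (false, val i) * nth 0 [seq pend S y | y <- s] i).
Proof.
rewrite (partition_big (fun x => Ordinal (label_lt x)) predT) //=.
apply: eq_bigr => i _; rewrite (bigID (fun x => (label x).1)) /=.
have fib b : \sum_(x | (Ordinal (label_lt x) == i) && ((label x).1 == b)) P (label x)
    = #|[set x | label x == (b, val i)]| * P (b, val i).
  rewrite (eq_bigr (fun=> P (b, val i))); last first.
    by move=> x /andP[/eqP <- /eqP <-]; rewrite -surjective_pairing.
  rewrite sum_nat_const; congr (_ * _); apply: eq_card => x.
  by rewrite !inE unfold_in -val_eqE /= [label x]surjective_pairing xpair_eqE andbC.
congr (_ + _).
  have := fib true; rewrite card_label ltn_ord mul1n => <-.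
  by apply: eq_bigl => x; rewrite eqb_id.
have := fib false; rewrite card_label mulnC => <-.
by apply: eq_bigl => x; rewrite eqbF_neg.
Qed.

Lemma caterpillar_card : #|G| = size s + sumn [seq pend S y | y <- s].
Proof.
rewrite -sum1_card (sum_label (fun=> 1)) big_split /=.
rewrite sum1_card card_ord; congr (_ + _).
rewrite sumnE (big_nth 0) size_map big_mkord.
by apply: eq_bigr => i _; rewrite mul1n.
Qed.

Lemma caterpillar_F : F G =
  sumn [seq pend S y | y <- s] + infix_sum [seq pend S y | y <- s].
Proof.
rewrite (F_pendants (S := S)); last first.
  by move=> x; rewrite inE => /pds[y ys e]; exists y; rewrite ?inE.
have [-> _] := wsub_path (pend S) ips; congr (_ + _).
have := cardsC S; rewrite caterpillar_card /S cardsE (card_uniqP _); last by case: ips.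
by move/addnI.
Qed.

(** Rank the spine vertices by position and all other vertices above them.  Each
    vertex but the first has a neighbour of smaller rank, which gives
    connectedness; and it has at most one neighbour of rank not exceeding its own,
    so a vertex of largest rank in a cycle would have equal successor and
    predecessor. *)
Lemma caterpillar_tree : s != [::] -> is_tree G.
Proof.
case es : s => [//|r s'] _; pose rank x := if x \in s then index x s else size s.
have rs : r \in s by rewrite es inE eqxx.
have down x : x != r -> exists2 y, adj x y & rank y < rank x.
  move=> nexr; rewrite /rank; case: ifPn => xs; last first.
    by have [y ys e] := pds xs; exists y; rewrite ?e // ys index_mem.
  have ix : 0 < index x s
    by rewrite es /=; case: (eqVneq r x) => [e|//]; rewrite e eqxx in nexr.
  have lt : (index x s).-1 < size s.
    by rewrite (leq_trans _ (_ : index x s <= _)) ?prednK ?index_size.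
  have us : uniq s by case: ips.
  exists (nth r s (index x s).-1); last by rewrite mem_nth // index_uniq // prednK.
  case: ips => _ ->; rewrite ?mem_nth // index_uniq // prednK // eqxx orbT //.
have up x y z : adj x y -> adj x z -> rank y <= rank x -> rank z <= rank x -> y = z.
  rewrite /rank; have [xs|xs] := boolP (x \in s); last first.
    by have [t _ e] := pds xs; rewrite !e => /eqP-> /eqP->.
  have spine t : adj x t -> (if t \in s then index t s else size s) <= index x s ->
      t \in s /\ (index t s).+1 = index x s.
    case: ifPn => ts; last by rewrite leqNgt index_mem xs.
    case: ips => _ -> // /orP[]/eqP<- //; by rewrite ltnn.
  move=> xy xz /(spine y xy)[ys ey] /(spine z xz)[zs]; rewrite -ey => -[e].
  by apply: (index_inj y ys zs); rewrite e.
split; first by apply/card_gt0P; exists r.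
  have toroot x : connect (@adj G) r x.
    have [n] := ubnP (rank x); elim: n x => // n IHn x; rewrite ltnS => le.
    have [->|/down[y xy lt]] := eqVneq x r; first exact: connect0.
    apply: connect_trans (IHn y (leq_trans lt le)) (connect1 _).
    by rewrite adj_sym.
  move=> x y; apply: connect_trans (toroot y).
  by rewrite (sym_connect_sym (@adj_sym G)).
move=> c uc; rewrite ltnNge; apply/negP=> c3.
have [x xc maxx] : exists2 x, x \in c & forall y, y \in c -> rank y <= rank x.
  have cc : nth r c 0 \in c by rewrite mem_nth // (leq_trans _ c3).
  by case: (@arg_maxnP _ (nth r c 0) (mem c) rank cc) => x xc mx; exists x.
have [i p ec] := rot_to xc.
have /andP[cyc un] : ucycle (@adj G) (x :: p).
  by rewrite -ec /ucycle rot_cycle rot_uniq; case/andP: uc => -> ->.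
have memp y : y \in x :: p -> rank y <= rank x by rewrite -ec mem_rot; apply: maxx.
have : 3 <= size (x :: p) by rewrite -ec size_rot.
case: p {ec} cyc un memp => [//|y p] /= /andP[xy pth] /and3P[_ yp _] memp.
move: pth; rewrite rcons_path => /andP[_ lx] sz.
have ey : y = last y p.
  apply: (up x) => //; first by rewrite adj_sym.
    by apply: memp; rewrite !inE eqxx orbT.
  by apply: memp; rewrite inE mem_last orbT.
by case: p sz yp ey {lx memp} => // a p _ yp ey; rewrite ey /= mem_last in yp.
Qed.

End Caterpillar.

(** The spine need not be a longest path: a vertex hanging at an end of it may also
    be counted as the next spine vertex. *)
Definition caterpillar (ws : seq nat) (G : sgraph) := exists s : seq G,
  [/\ induced_path s, pendant_outside s & [seq pend [set x in s] y | y <- s] = ws].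

Lemma caterpillar_giso ws G H : ws != [::] ->
  caterpillar ws G -> caterpillar ws H -> giso G H.
Proof.
move=> ws0 [s [is_ ps es]] [t [it pt et]].
have [x0 _] : exists x, x \in s.
  by case: s es {is_ ps} ws0 => [<-//|x s _ _]; exists x; rewrite inE eqxx.
have [y0 _] : exists x, x \in t.
  by case: t et {it pt} ws0 => [<-//|x t _ _]; exists x; rewrite inE eqxx.
apply: (giso_labels x0 y0 (labelP is_ ps) (labelP it pt)) => -[b i].
rewrite !card_label // es et.
by move: (congr1 size es) (congr1 size et); rewrite !size_map => -> ->.
Qed.

Lemma caterpillar_subtrees ws G : caterpillar ws G -> F G = sumn ws + infix_sum ws.
Proof. by case=> s [is_ ps <-]; apply: caterpillar_F. Qed.

Lemma caterpillar_is_tree ws G : ws != [::] -> caterpillar ws G -> is_tree G.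
Proof.
move=> ws0 [s [is_ ps es]]; apply: caterpillar_tree is_ ps _.
by apply: contraNneq ws0 => s0; rewrite -es s0.
Qed.

Lemma caterpillar_order ws G : caterpillar ws G -> #|G| = size ws + sumn ws.
Proof. by case=> s [is_ ps <-]; rewrite size_map; apply: caterpillar_card. Qed.

Lemma has_bipartitionC p q G : has_bipartition p q G -> has_bipartition q p G.
Proof.
case=> V [cV cV' bV]; exists (~: V); split; rewrite ?setCK // => x y /bV.
by rewrite !inE; case: (_ \in _); case: (_ \in _).
Qed.

(** The spine alternates between the classes, and a vertex hanging at position i is
    in the class of the spine vertices of parity opposite to i. *)
Lemma caterpillar_bipartition ws G p q : caterpillar ws G ->
  \sum_(i < size ws) (if odd i then 1 else nth 0 ws i) = p ->
  size ws + sumn ws = p + q -> has_bipartition p q G.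
Proof.
move=> cat; have := caterpillar_order cat; case: cat => s [is_ ps es] n ep en.
pose P (l : bool * nat) := odd (l.2 + ~~ l.1).
have cp : #|[set x | P (label s x)]| = p.
  rewrite -sum1_card big_mkcond -[RHS]ep -es size_map.
  rewrite (eq_bigr (fun x => P (label s x) : nat)); last first.
    by move=> x _; rewrite inE; case: (P _).
  rewrite (sum_label is_ ps (fun l => P l : nat)); apply: eq_bigr => i _.
  by rewrite /P addn0 addn1 /=; case: (odd i); rewrite ?mul1n.
exists [set x | P (label s x)]; split=> //.
  by apply: (@addnI p); rewrite -{1}cp cardsC n en.
move=> x y; rewrite (labelP is_ ps) !inE /P.
case: (label s x) (label s y) => [[] i] [[] j] //=; rewrite ?addn0 ?addn1.
- by case/orP => /eqP<- /=; case: (odd _).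
- by move/eqP->; rewrite /=; case: (odd _).
by move/eqP->; rewrite /=; case: (odd _).
Qed.

Lemma caterpillar_bip_tree ws G n p q : ws != [::] -> caterpillar ws G ->
  p + q = n -> size ws + sumn ws = n ->
  (\sum_(i < size ws) (if odd i then 1 else nth 0 ws i) = p \/
   \sum_(i < size ws) (if odd i then 1 else nth 0 ws i) = q) ->
  bip_tree n p q G.
Proof.
move=> ws0 cat hpq en e; split.
- by rewrite (caterpillar_order cat).
- exact: caterpillar_is_tree cat.
case: e => e; first by apply: caterpillar_bipartition cat e _; rewrite en.
by apply/has_bipartitionC/(caterpillar_bipartition cat e); rewrite en addnC.
Qed.

Section Tree.
Variable G : sgraph.
Implicit Types (x y z : G) (s : seq G).

Lemma sorted_connected x s : sorted (@adj G) (x :: s) -> connected_set [set y in x :: s].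
Proof.
elim: s x => [|y s IHs] x.
  by rewrite (_ : [set y in [:: x]] = [set x]) ?connected_set1 //; apply/setP=> z; rewrite !inE.
move=> /= /andP[xy ps]; rewrite (_ : [set _ in _] = [set x] :|: [set z in y :: s]).
  apply: connected_setU xy; rewrite ?inE ?eqxx ?connected_set1 //; exact: IHs.
by apply/setP=> z; rewrite !inE.
Qed.

(** A chord of a path would be a second edge from a vertex to the connected rest of
    the path. *)
Lemma tree_induced_path s : is_tree G -> uniq s -> sorted (@adj G) s -> induced_path s.
Proof.
move=> tG us ss; split=> //; elim: s us ss => [//|x s IHs] /= /andP[xs us] ps.
have {}IHs := IHs us (path_sorted ps).
have adjx y : y \in s -> adj x y = (index y s == 0).
  case: s xs us ps {IHs} => [//|z s] xs us /= /andP[xz ps] ys.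
  have cs : connected_set [set y in z :: s] by apply: sorted_connected.
  rewrite /=; case: (eqVneq z y) => [<-//|nezy] /=; apply/negbTE/negP=> xy.
  have xC : x \notin [set y in z :: s] by rewrite inE.
  case/eqP: nezy; apply: (tree_adj1 tG cs xC _ _ xz xy); rewrite inE //.
  by rewrite inE eqxx.
have ne a : a \in s -> (x == a) = false.
  by move=> sa; apply: contraNF xs => /eqP->.
move=> y z; rewrite !inE => /predU1P[->|ys] /predU1P[->|zs].
- by rewrite adj_irr eqxx.
- by rewrite eqxx ne // adjx // eqSS [0 == _]eq_sym /= orbF.
- by rewrite eqxx ne // adj_sym adjx // eqSS [0 == _]eq_sym /=.
by rewrite !ne // IHs // !eqSS.
Qed.

(** Two adjacent vertices outside the spine, both with a neighbour on it, would give
    one of them two neighbours in the connected set formed by the spine and the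
    other. *)
Lemma tree_pendant_outside s : is_tree G -> s != [::] -> sorted (@adj G) s ->
  (forall x, x \notin s -> exists2 y, y \in s & adj x y) -> pendant_outside s.
Proof.
move=> tG s0 ss dom x xs.
have cs : connected_set [set y in s].
  by case: s s0 ss {dom xs} => // y s _; apply: sorted_connected.
have [y ys xy] := dom x xs; exists y => // z; apply/idP/eqP=> [xz|->//].
have xS : x \notin [set y in s] by rewrite inE.
have [zs|zs] := boolP (z \in s); first by apply: (tree_adj1 tG cs xS); rewrite ?inE.
have [t ts zt] := dom z zs; have tz : adj t z by rewrite adj_sym.
have cC : connected_set ([set y in s] :|: [set z]).
  by apply: connected_setU tz; rewrite ?connected_set1 ?inE.
apply: (tree_adj1 tG cC (v := x)); rewrite ?inE ?eqxx ?orbT ?ys //.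
by rewrite negb_or xs; apply: contraTneq xz => ->; rewrite adj_irr.
Qed.

Lemma tree_caterpillar s : is_tree G -> uniq s -> s != [::] -> sorted (@adj G) s ->
  (forall x, x \notin s -> exists2 y, y \in s & adj x y) ->
  caterpillar [seq pend [set x in s] y | y <- s] G.
Proof.
move=> tG us s0 ss dom; exists s; split=> //; first exact: tree_induced_path.
exact: tree_pendant_outside.
Qed.

Lemma caterpillar_rev ws : is_tree G -> ws != [::] -> caterpillar ws G ->
  caterpillar (rev ws) G.
Proof.
move=> tG ws0 [s [[us adjs] ps es]].
have s0 : s != [::] by apply: contraNneq ws0 => s0; rewrite -es s0.
have ss : sorted (@adj G) s.
  case: s us adjs {ps es s0} => // a s us adjs; apply/(pathP a) => i lti.
  have si : size (a :: s) = (size s).+1 by [].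
  rewrite -[nth a s i]/(nth a (a :: s) i.+1) adjs ?mem_nth ?si ?ltnS // ?(ltnW lti) //.
  by rewrite !index_uniq ?si ?ltnS ?(ltnW lti) // eqxx.
rewrite -es -map_rev; exists (rev s); split; last first.
- apply: eq_map => y; rewrite /pend; apply: eq_card => x.
  by rewrite !inE mem_rev.
- by move=> x; rewrite mem_rev => /ps[y ys e]; exists y; rewrite ?mem_rev.
apply: tree_induced_path; rewrite ?rev_uniq // rev_sorted.
by apply: sub_sorted ss => x y; rewrite adj_sym.
Qed.

End Tree.

(** * Inequalities between the bounds *)

Lemma leq_exists m n : m <= n -> exists k, n = k + m.
Proof. by move=> le_mn; exists (n - m); rewrite subnK. Qed.

(** The induction step of [rooted_bound].  On the side of the root let a be the
    number of vertices in the class of the root and b that in the other class, and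
    let c and d be the corresponding numbers on the far side of the edge; A = 2^a,
    and so on. *)
Lemma rooted_bound_step A B C D x y : 2 <= A -> 1 <= B -> 1 <= C -> 2 <= D ->
  4 * x <= B * (A + 2) -> 4 * y <= C * (D + 2) ->
  4 * (x * (1 + y)) <= B * D * (A * C + 2) /\
  (4 * (x * (1 + y)) = B * D * (A * C + 2) -> D = 2 /\ 4 * x = B * (A + 2)).
Proof.
move=> /leq_exists[a ->] hB /leq_exists[c ->] /leq_exists[d ->].
set X := B * _; set Y := (c + 1) * _ => /leq_exists[s ex] /leq_exists[t et].
have id : 4 * (B * (d + 2) * ((a + 2) * (c + 1) + 2)) =
    X * (4 + Y) + B * (4 * (a * c) + d * ((c + 1) * (3 * a + 4) + 8)).
  by rewrite /X /Y; ring.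
have id2 : X * (4 + Y) = 4 * (4 * (x * (1 + y))) + (4 * s + s * Y + 4 * (x * t)).
  by rewrite ex et; ring.
have hd : d <= B * (4 * (a * c) + d * ((c + 1) * (3 * a + 4) + 8)).
  rewrite -{1}[d]mul1n leq_mul // (leq_trans _ (leq_addl _ _)) // leq_pmulr //.
  by rewrite addn_gt0 orbT.
by split; lia.
Qed.

Lemma mul_bounds X Y x y : 0 < X -> 0 < Y -> 4 * x <= X -> 4 * y <= Y ->
  16 * (x * y) <= X * Y /\
  (16 * (x * y) = X * Y -> 4 * x = X /\ 4 * y = Y).
Proof.
move=> X0 Y0 /leq_exists[s ex] /leq_exists[t et].
have e1 : X * Y = 16 * (x * y) + (s * Y + 4 * (x * t)) by rewrite ex et; ring.
have e2 : X * Y = 16 * (x * y) + (X * t + s * (4 * y)) by rewrite ex et; ring.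
have hs : s <= s * Y by rewrite leq_pmulr.
have ht : t <= X * t by rewrite leq_pmull.
split; lia.
Qed.

(** Let the sides of a bridge uv have class sizes a, b and c, d, with u counted in a
    and v in d, and put A = 2^a, and so on.  Up to the term 16 (a + b + c + d) - 64,
    this is 16 times the bound on F obtained from the bounds on either side. *)
Definition cross_bound A B C D :=
  4 * (A * B) + 8 * A + 8 * B + 4 * (C * D) + 8 * C + 8 * D
  + B * (A + 2) * (C * (D + 2)).

(** After substituting a + 2, b + 1, c + 1, d + 2 for A, B, C, D the difference of
    the two sides has nonnegative coefficients only; likewise, with other shifts,
    in the next two lemmas. *)
Lemma cross_bound_le_max A B C D : 2 <= A -> 1 <= B -> 1 <= C -> 2 <= D ->
  cross_bound A B C D <= 4 * (A * C * (B * D)) + 8 * (A * C) + 8 * (B * D) + 32 /\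
  (cross_bound A B C D = 4 * (A * C * (B * D)) + 8 * (A * C) + 8 * (B * D) + 32 ->
    2 <= B -> 2 <= C -> A = 2 /\ D = 2).
Proof.
move=> /leq_exists[a ->] /leq_exists[b ->] /leq_exists[c ->] /leq_exists[d ->].
set E := 4 * (_ * _ * (_ * _)) + _ + _ + _.
set r := a * c * (3 * b * d + 4 * b + 3 * d + 12) + 3 * b * a * d + 3 * a * d + b * d * (4 * c + 12).
have eE : E = cross_bound (a + 2) (b + 1) (c + 1) (d + 2) + r.
  by rewrite /E /cross_bound /r; ring.
clearbody E; rewrite eE.
split; first exact: leq_addr.
move=> e hb hc; have r0 : r = 0 by clearbody r; lia.
have b1 : 1 <= b by lia.
have c1 : 1 <= c by lia.
have ha : a <= r.
  rewrite /r -!addnA (leq_trans _ (leq_addr _ _)) // -mulnA leq_pmulr //.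
  by rewrite muln_gt0 c1 !addn_gt0 !orbT.
have hd : d <= r.
  rewrite /r (leq_trans _ (leq_addl _ _)) // mulnAC leq_pmull //.
  by rewrite muln_gt0 b1 addn_gt0 orbT.
by lia.
Qed.

Lemma cross_bound_le_lopsided A B C D : 4 <= A -> 2 <= B -> 2 <= C -> D = 2 ->
  cross_bound A B C D <= 3 * (A * C * (B * D)) + 12 * (B * D) + 4 * (A * C) + 48 /\
  (cross_bound A B C D = 3 * (A * C * (B * D)) + 12 * (B * D) + 4 * (A * C) + 48 ->
   A = 4 \/ C = 2).
Proof.
move=> /leq_exists[a ->] /leq_exists[b ->] /leq_exists[c ->] ->.
set E := 3 * _ + _ + _ + _.
have eE : E = cross_bound (a + 4) (b + 2) (c + 2) 2 + a * c * (2 * b + 8).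
  by rewrite /E /cross_bound; ring.
clearbody E; rewrite eE.
split=> [|e]; first exact: leq_addr.
have /eqP : a * c * (2 * b + 8) = 0 by lia.
by rewrite !muln_eq0 addn_eq0 !andbF orbF => /orP[/eqP->|/eqP->]; [left|right].
Qed.

Lemma cross_bound_lt_lopsided A B C D : 4 <= A -> 2 <= B -> 2 <= C -> 4 <= D ->
  cross_bound A B C D < 3 * (A * C * (B * D)) + 12 * (B * D) + 4 * (A * C) + 48.
Proof.
move=> /leq_exists[a ->] /leq_exists[b ->] /leq_exists[c ->] /leq_exists[d ->].
set E := (X in _ < X).
set r := 2*a*b*c*d + 6*a*b*c + 4*a*b*d + 8*a*b + 4*a*c*d+16*a*c+8*a*d+16*a
  +6*b*c*d+12*b*c+24*b*d+48*b+8*c*d+16*c+32*d+64.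
have eE : E = cross_bound (a + 4) (b + 2) (c + 2) (d + 4) + r.
  by rewrite /E /cross_bound /r; ring.
clearbody E; rewrite eE.
by rewrite -[X in X < _]addn0 ltn_add2l /r addn_gt0 orbT.
Qed.

Lemma bridge_cross_bound A B C D WC WD x y a b c d :
  4 * WC + 8 <= A * B + 2 * A + 2 * B + 4 * (a + b) ->
  4 * WD + 8 <= C * D + 2 * C + 2 * D + 4 * (c + d) ->
  16 * (x * y) <= B * (A + 2) * (C * (D + 2)) ->
  16 * (WC + WD + x * y) + 64 <= cross_bound A B C D + 16 * (a + c + (b + d)) /\
  (16 * (WC + WD + x * y) + 64 = cross_bound A B C D + 16 * (a + c + (b + d)) ->
   4 * WC + 8 = A * B + 2 * A + 2 * B + 4 * (a + b) /\
   16 * (x * y) = B * (A + 2) * (C * (D + 2))).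
Proof.
rewrite /cross_bound; set X := B * _ * _; set Y := x * y.
set AB := A * B; set CD := C * D; clearbody X Y AB CD; lia.
Qed.

Lemma cross_bound_subtrees W X P Q n :
  16 * W + 64 <= X + 16 * n -> X <= 4 * (P * Q) + 8 * P + 8 * Q + 32 ->
  4 * W + 8 <= P * Q + 2 * P + 2 * Q + 4 * n /\
  (4 * W + 8 = P * Q + 2 * P + 2 * Q + 4 * n ->
    X = 4 * (P * Q) + 8 * P + 8 * Q + 32).
Proof. by set PQ := P * Q; clearbody PQ; lia. Qed.

Lemma cross_bound_lopsided W X Y n : 16 * W + 64 <= X + 16 * n -> X <= Y + 48 ->
  16 * W + 16 <= Y + 16 * n /\
  (16 * W + 16 = Y + 16 * n -> 16 * W + 64 = X + 16 * n /\ X = Y + 48).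
Proof. lia. Qed.

(** * Upper bounds in terms of the bipartition *)

Section RootedBound.
Variable G : sgraph.
Implicit Types (A B C D S V : {set G}) (u v x y z : G) (w : G -> nat).

Definition bipartition V := forall x y : G, adj x y -> (x \in V) != (y \in V).

Lemma bipartitionC V : bipartition V -> bipartition (~: V).
Proof. by move=> bV x y /bV; rewrite !inE; case: (x \in V); case: (y \in V). Qed.

Lemma cardsIU V C D : [disjoint C & D] ->
  #|(C :|: D) :&: V| = #|C :&: V| + #|D :&: V|.
Proof.
rewrite -setI_eq0 => /eqP dCD.
by rewrite setIUl cardsU setIACA setIid dCD set0I cards0 subn0.
Qed.

Lemma cardsDU V C D : [disjoint C & D] ->
  #|(C :|: D) :\: V| = #|C :\: V| + #|D :\: V|.
Proof. by rewrite !setDE; apply: cardsIU. Qed.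

Lemma bridge_card_lt C D u v :
  bridge C D u v -> (#|C| < #|C :|: D|) && (#|D| < #|C :|: D|).
Proof.
case=> dCD uC vD _ _; rewrite cardsU (eqP (_ : C :&: D == set0)) ?setI_eq0 //.
rewrite cards0 subn0 -addn1 -[in X in _ && X]add1n leq_add2l leq_add2r.
by rewrite !card_gt0; apply/andP; split; apply/set0Pn; [exists v|exists u].
Qed.

Lemma connected_nbr S u : connected_set S -> u \in S -> S != [set u] ->
  exists2 v, v \in S & adj u v.
Proof.
move=> cS uS neS; have [|||x [y []]] := connected_setP S cS [set u].
- by rewrite sub1set.
- by apply/set0Pn; exists u; rewrite inE.
- by rewrite eq_sym.
by rewrite inE => /eqP-> /setDP[yS _] uy; exists y.
Qed.

(** Both statements are trivial for a single vertex and propagate along the edge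
    from u to one of its neighbours.  The factor 4 clears the denominators of
    2^(b-1) (2^(a-1) + 1), which also has the right value for a = 1 and b = 0. *)
Lemma rooted_bound V S u :
  is_tree G -> bipartition V -> connected_set S -> u \in S -> u \in V ->
  4 * wsub_at (fun=> 0) S u <= 2 ^ #|S :\: V| * (2 ^ #|S :&: V| + 2) /\
  (4 * wsub_at (fun=> 0) S u = 2 ^ #|S :\: V| * (2 ^ #|S :&: V| + 2) ->
   forall v, v \in S :\: V -> adj u v).
Proof.
move=> tG; have [n] := ubnP #|S|; elim: n => // n IHn in V S u *.
rewrite ltnS => leS bV cS uS uV.
have [->|neS] := eqVneq S [set u].
  have e1 : [set u] :&: V = [set u] by apply/setIidPl; rewrite sub1set.
  have e2 : [set u] :\: V = set0 by apply/eqP; rewrite setD_eq0 sub1set.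
  by rewrite e1 e2 cards1 cards0 wsub_at1; split=> // _ v; rewrite inE.
have [v vS uv] := connected_nbr cS uS neS.
have [C [D [eS br cC cD]]] := tree_bridge tG cS uS vS uv.
have [dCD uC vD _ _] := br.
have vV : v \in ~: V by have := bV u v uv; rewrite uV inE; case: (v \in V).
have /andP[ltC ltD] := bridge_card_lt br; rewrite -eS in ltC ltD.
have [IC eqC] := IHn V C u (leq_trans ltC leS) bV cC uC uV.
have [ID _] := IHn (~: V) D v (leq_trans ltD leS) (bipartitionC bV) cD vD vV.
rewrite -setDE setDE setCK in ID.
rewrite eS cardsIU // cardsDU // !expnD (bridge_wsub_at _ br).
have [||||le eq] := rooted_bound_step _ _ _ _ IC ID.
- rewrite -{1}(expn1 2) leq_exp2l // card_gt0; apply/set0Pn; exists u.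
  by rewrite inE uC.
- by rewrite expn_gt0.
- by rewrite expn_gt0.
- rewrite -{1}(expn1 2) leq_exp2l // card_gt0; apply/set0Pn; exists v.
  by move: vV; rewrite !inE vD => ->.
split=> // /eq[] /eqP eD eC x.
rewrite inE => /andP[xV]; rewrite inE => /orP[xC|xD].
  by apply: eqC => //; rewrite inE xV.
have /cards1P[z ez] : #|D :\: V| == 1.
  by move: eD; rewrite -[X in _ == X](expn1 2) eqn_exp2l.
have : x \in D :\: V by rewrite inE xV.
have : v \in D :\: V by move: vV; rewrite !inE vD => ->.
by rewrite ez !inE => /eqP <- /eqP->.
Qed.

End RootedBound.

Section SubtreeBound.
Variable G : sgraph.
Implicit Types (A B C D S V : {set G}) (u v x y z : G) (w : G -> nat).

Lemma nbr_side V u v : bipartition V -> adj u v -> (v \in V) = (u \notin V).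
Proof. by move=> bV /bV; case: (u \in V); case: (v \in V). Qed.

Lemma card1_eq (X : {set G}) x y : #|X| = 1 -> x \in X -> y \in X -> x = y.
Proof. by move/eqP/cards1P=> [z ->]; rewrite !inE => /eqP-> /eqP. Qed.

(** Every vertex of S in the class V has a neighbour in S, and v is the only
    candidate. *)
Lemma adj_single_side V S v y : bipartition V -> connected_set S ->
  #|S :\: V| = 1 -> v \in S :\: V -> y \in S :&: V -> adj v y.
Proof.
move=> bV cS S1 vS; have := vS; rewrite !inE => /andP[vV vS'] /andP[yS yV].
have [|x xS yx] := connected_nbr cS yS.
  by apply: contraNneq vV => eS; move: vS'; rewrite eS inE => /eqP->.
rewrite adj_sym (_ : v = x) //; apply: (card1_eq S1) => //.
by rewrite inE xS (nbr_side bV yx) yV.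
Qed.

(** If the neighbours of u had no further neighbours, u would be the only vertex of
    its class. *)
Lemma second_nbr V S u : bipartition V -> connected_set S -> u \in S :&: V ->
  1 < #|S :&: V| ->
  exists v y, [/\ v \in S :\: V, y \in (S :&: V) :\ u, adj u v & adj v y].
Proof.
move=> bV cS /setIP[uS uV] S1; pose N := u |: [set v in S | adj u v].
have [|||x [y []]] := connected_setP S cS N.
- by apply/subsetP=> v; rewrite !inE => /orP[/eqP->|/andP[]].
- by apply/set0Pn; exists u; rewrite !inE eqxx.
- apply: contraTneq S1 => eN; rewrite -leqNgt -(cards1 u) subset_leq_card //.
  apply/subsetP=> v /setIP[]; rewrite -eN !inE => /orP[//|/andP[_ uv]].
  by rewrite (nbr_side bV uv) uV.
rewrite !inE negb_or => /orP[/eqP->|/andP[xS ux]].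
  by case/andP=> /andP[_ nuy] yS uy; rewrite yS uy in nuy.
case/andP=> /andP[neyu nuy] yS xy; exists x, y; split=> //.
  by rewrite inE (nbr_side bV ux) uV.
by rewrite !inE neyu yS (nbr_side bV xy) (nbr_side bV ux) uV.
Qed.

(** Two applications of [second_nbr] give a path with four vertices; its middle
    edge is as required. *)
Lemma internal_edge V S : bipartition V -> connected_set S ->
  1 < #|S :&: V| -> 1 < #|S :\: V| ->
  exists u v, [/\ u \in S :&: V, v \in S :\: V, adj u v,
    exists2 x, x \in (S :\: V) :\ v & adj u x
  & exists2 y, y \in (S :&: V) :\ u & adj v y].
Proof.
move=> bV cS p1 q1; have [u0 u0S] : exists u, u \in S :&: V.
  by apply/set0Pn; rewrite -card_gt0 ltnW.
have [v [u1 [vS u1S u0v vu1]]] := second_nbr bV cS u0S p1.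
have [||u [x [uS xS vu ux]]] := second_nbr (V := ~: V) (bipartitionC bV) cS (u := v).
- by rewrite -setDE.
- by rewrite -setDE.
rewrite setDE setCK in uS; rewrite -setDE in xS.
exists u, v; split=> //; first by rewrite adj_sym.
  by exists x.
have [eu|neu] := eqVneq u u0; last by exists u0; rewrite 1?adj_sym // in_setD1 eq_sym neu.
by exists u1; rewrite ?eu.
Qed.

Lemma exp2_ge2 (X : {set G}) x : x \in X -> 2 <= 2 ^ #|X|.
Proof.
by move=> xX; rewrite -{1}(expn1 2) leq_exp2l // card_gt0; apply/set0Pn; exists x.
Qed.

(** The bound is 4 F + 8 for a double star with these class sizes.  Any edge will do
    for the inequality.  If both classes have at least two vertices, the edge is
    chosen with no leaf among its ends; equality then makes both sides stars. *)
Lemma subtree_bound V S :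
  is_tree G -> bipartition V -> connected_set S -> S != set0 ->
  4 * wsub (fun=> 0) S + 8 <= 2 ^ #|S :&: V| * 2 ^ #|S :\: V| + 2 * 2 ^ #|S :&: V|
     + 2 * 2 ^ #|S :\: V| + 4 * (#|S :&: V| + #|S :\: V|) /\
  (4 * wsub (fun=> 0) S + 8 = 2 ^ #|S :&: V| * 2 ^ #|S :\: V| + 2 * 2 ^ #|S :&: V|
     + 2 * 2 ^ #|S :\: V| + 4 * (#|S :&: V| + #|S :\: V|) ->
   S :\: V != set0 ->
   exists2 x, x \in S :\: V & forall y, y \in S :&: V -> adj x y).
Proof.
move=> tG bV; have [n] := ubnP #|S|; elim: n => // n IHn in S *.
rewrite ltnS => leS cS /set0Pn[u0 u0S].
have [eS|neS] := eqVneq S [set u0].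
  have e1 := cardsID V S; split.
    rewrite eS cards1 -eS in e1; rewrite [in wsub _ _]eS wsub_set1.
    have : #|S :&: V| <= 1 by rewrite -e1 leq_addr.
    rewrite -[#|S :\: V|](addKn #|S :&: V|) e1 /=.
    by case: #|S :&: V| => [|[|k]].
  move=> _ /set0Pn[x xS]; exists x => // y /setIP[yS yV].
  by move: yS yV xS; rewrite eS !inE => /eqP-> uV /andP[xV /eqP xu]; rewrite xu uV in xV.
have [u [v [uV vV uS vS uv]]] :
  exists u v, [/\ u \in V, v \notin V, u \in S, v \in S & adj u v].
  have [v0 v0S uv0] := connected_nbr cS u0S neS.
  have vV := nbr_side bV uv0; have [uV|uV] := boolP (u0 \in V).
    by exists u0, v0; rewrite vV uV.
  by exists v0, u0; rewrite vV uV adj_sym.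
have {u0 u0S neS} star : (#|S :&: V| <= 1) || (#|S :\: V| <= 1) ->
   exists2 x, x \in S :\: V & forall y, y \in S :&: V -> adj x y.
  have vSV : v \in S :\: V by rewrite inE vV.
  have uSV : u \in S :&: V by rewrite inE uS.
  move=> le1; exists v => // y yS; case/orP: le1 => le1; last first.
    apply: (adj_single_side bV cS _ vSV yS); apply/eqP; rewrite eqn_leq le1 card_gt0.
    by apply/set0Pn; exists v.
  rewrite (_ : y = u) 1?adj_sym //; apply: (card1_eq (X := S :&: V)) => //.
  by apply/eqP; rewrite eqn_leq le1 card_gt0; apply/set0Pn; exists u.
have {u v uV vV uS vS uv} [u [v [uV vV uS [vS uv inn]]]] :
  exists u v, [/\ u \in V, v \notin V, u \in S & [/\ v \in S, adj u v &
    1 < #|S :&: V| -> 1 < #|S :\: V| ->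
    (exists2 x, x \in (S :\: V) :\ v & adj u x)
    /\ (exists2 y, y \in (S :&: V) :\ u & adj v y)]].
  have [/andP[p1 q1]|npq] := boolP ((1 < #|S :&: V|) && (1 < #|S :\: V|)).
    have [a [b [/setIP[aS aV] /setDP[bS bV'] ab hx hy]]] := internal_edge bV cS p1 q1.
    by exists a, b.
  exists u, v; split=> //; split=> // p1 q1; by rewrite p1 q1 in npq.
have [C [D [eS br cC cD]]] := tree_bridge tG cS uS vS uv.
have [dCD uC vD _ cross] := br.
have /andP[ltC ltD] := bridge_card_lt br; rewrite -eS in ltC ltD.
have [|IC _] := IHn C (leq_trans ltC leS) cC; first by apply/set0Pn; exists u.
have [|ID _] := IHn D (leq_trans ltD leS) cD; first by apply/set0Pn; exists v.
have [RC _] := rooted_bound tG bV cC uC uV.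
have vV' : v \in ~: V by rewrite inE.
have [RD _] := rooted_bound tG (bipartitionC bV) cD vD vV'.
rewrite -setDE setDE setCK in RD.
have uCV : u \in C :&: V by rewrite inE uC.
have vDV : v \in D :\: V by rewrite inE vV.
have A2 := exp2_ge2 uCV; have D2 := exp2_ge2 vDV.
have B0 : 0 < 2 ^ #|C :\: V| by rewrite expn_gt0.
have C0 : 0 < 2 ^ #|D :&: V| by rewrite expn_gt0.
have [||N2 _] := mul_bounds _ _ RC RD; rewrite ?muln_gt0 ?expn_gt0 ?addn_gt0 ?orbT //.
have [N3 E3] := cross_bound_le_max A2 B0 C0 D2.
have eI : #|S :&: V| = #|C :&: V| + #|D :&: V| by rewrite eS cardsIU.
have eD : #|S :\: V| = #|C :\: V| + #|D :\: V| by rewrite eS cardsDU.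
have [N6 _] := bridge_cross_bound IC ID N2.
rewrite -(bridge_wsub _ br) -eS -eI -eD in N6.
rewrite -!expnD -eI -eD expnD in N3 E3.
have [le eq] := cross_bound_subtrees N6 N3.
split=> // e _.
have [/andP[p1 q1]|] := boolP ((1 < #|S :&: V|) && (1 < #|S :\: V|)); last first.
  by rewrite negb_and -!leqNgt; exact: star.
have [[x /setD1P[nexv /setDP[xS xV]] ux] [y /setD1P[neyu /setIP[yS yV]] vy]] := inn p1 q1.
have xC : x \in C.
  move: xS; rewrite eS inE => /orP[//|xD]; have [_ exv] := cross u x uC xD ux.
  by rewrite exv eqxx in nexv.
have yD : y \in D.
  rewrite adj_sym in vy; move: yS; rewrite eS inE => /orP[yC|//].
  by have [eyu _] := cross y v yC vD vy; rewrite eyu eqxx in neyu.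
have [||eA eD2] := E3 (eq e).
- by apply: (exp2_ge2 (x := x)); rewrite inE xV.
- by apply: (exp2_ge2 (x := y)); rewrite inE yV andbT.
have D1 : #|D :\: V| = 1 by apply/eqP; rewrite -(eqn_exp2l (m := 2)) // eD2.
have A1 : #|C :&: V| = 1 by apply/eqP; rewrite -(eqn_exp2l (m := 2)) // eA.
exists v => [|z]; first by rewrite inE vV.
rewrite inE eS inE => /andP[/orP[zC|zD] zV].
  rewrite (_ : z = u) 1?adj_sym //; apply: (card1_eq A1) => //.
  by rewrite inE zC.
by apply: (adj_single_side bV cD D1 vDV); rewrite inE zD.
Qed.

End SubtreeBound.

Section SecondBound.
Variable G : sgraph.
Implicit Types (A B C D S V : {set G}) (u v x y z : G) (w : G -> nat) (s : seq G).

Lemma pend_eq S y (E : {set G}) : (forall x, x \notin S -> adj x y -> x \in E) ->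
  (forall x, x \in E -> x \notin S /\ adj x y) -> pend S y = #|E|.
Proof.
move=> h1 h2; apply: eq_card => x; rewrite !inE; apply/andP/idP => [[xS xy]|/h2 //].
exact: h1.
Qed.

(** Each side has a single vertex in one of the classes, so it is a star centred at
    that vertex. *)
Lemma double_star_caterpillar V C D u v : is_tree G -> bipartition V ->
  bridge C D u v -> C :|: D = setT -> connected_set C -> connected_set D ->
  u \in V -> v \notin V -> #|C :&: V| = 1 -> #|D :\: V| = 1 ->
  caterpillar [:: #|V|.-1; #|~: V|.-1] G.
Proof.
move=> tG bV br eT cC cD uV vV a1 d1; have [dCD uC vD uv cross] := br.
have CD z : z \in C \/ z \in D by apply/orP; rewrite -in_setU eT inE.
have uCV : u \in C :&: V by rewrite inE uC.
have vDV : v \in D :\: V by rewrite inE vV.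
have nCD z : z \in C -> z \notin D by move=> zC; rewrite (disjointFr dCD zC).
have adjv z : z \in D :&: V -> adj z v.
  by move=> zD; rewrite adj_sym; apply: (adj_single_side bV cD d1 vDV).
have adju z : z \in C :\: V -> adj z u.
  rewrite setDE => zC; rewrite adj_sym.
  by apply: (adj_single_side (bipartitionC bV) cC _ _ zC); rewrite setDE setCK.
have cV : #|V| = #|C :&: V| + #|D :&: V|.
  by rewrite -cardsIU // eT setTI.
have cV' : #|~: V| = #|C :\: V| + #|D :\: V|.
  by rewrite -cardsDU // eT setTD.
pose s := [:: v; u].
have us : uniq s by rewrite /= inE andbT; apply: contraNneq vV => ->.
have dom x : x \notin s -> exists2 y, y \in s & adj x y.
  rewrite !inE negb_or => /andP[nxv nxu].
  have [xV|xV] := boolP (x \in V); have [xC|xD] := CD x.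
  - by case/eqP: nxu; apply: (card1_eq a1); rewrite // inE xC.
  - by exists v; rewrite ?inE ?eqxx //; apply: adjv; rewrite inE xD.
  - by exists u; rewrite ?inE ?eqxx ?orbT //; apply: adju; rewrite inE xC xV.
  by case/eqP: nxv; apply: (card1_eq d1); rewrite // inE xD xV.
suff <- : [seq pend [set x in s] y | y <- s] = [:: #|V|.-1; #|~: V|.-1].
  by apply: tree_caterpillar; rewrite // /= adj_sym uv.
rewrite cV cV' a1 d1 add1n addn1 /=; congr [:: _; _].
  apply: pend_eq => x; rewrite !inE ?negb_or.
    case/andP=> nxv nxu xv; rewrite (nbr_side bV (_ : adj v x)) 1?adj_sym // vV andbT.
    by have [xC|//] := CD x; case/eqP: nxu; case: (cross x v xC vD xv).
  case/andP=> xD xV; rewrite adjv ?inE ?xD ?xV //; split=> //; apply/andP; split.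
    by apply: contraNneq vV => <-.
  by apply: contraTneq xD => ->; apply: nCD.
apply: pend_eq => x; rewrite !inE ?negb_or.
  case/andP=> nxv nxu xu; rewrite (nbr_side bV (_ : adj u x)) 1?adj_sym // uV /=.
  have [//|xD] := CD x; rewrite adj_sym in xu.
  by case/eqP: nxv; case: (cross u x uC xD xu).
case/andP=> xV xC; rewrite adju ?inE ?xC ?xV //; split=> //; apply/andP; split.
  by apply: contraTneq vD => <-; apply: nCD.
by apply: contraNneq xV => ->.
Qed.

Lemma spine3_caterpillar V C D u v x0 : is_tree G -> bipartition V ->
  bridge C D u v -> C :|: D = setT -> connected_set D ->
  u \in V -> v \notin V -> #|D :\: V| = 1 -> x0 \in C :\: V ->
  (forall z, z \in C :\: V -> adj u z) -> (forall z, z \in C :&: V -> adj x0 z) ->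
  caterpillar [:: #|D :&: V|; #|C :\: V|.-1; #|C :&: V|.-1] G.
Proof.
move=> tG bV br eT cD uV vV d1 x0C domu domx; have [dCD uC vD uv cross] := br.
have CD z : z \in C \/ z \in D by apply/orP; rewrite -in_setU eT inE.
have uCV : u \in C :&: V by rewrite inE uC.
have vDV : v \in D :\: V by rewrite inE vV.
have nCD z : z \in C -> z \notin D by move=> zC; rewrite (disjointFr dCD zC).
have adjv z : z \in D :&: V -> adj z v.
  by move=> zD; rewrite adj_sym; apply: (adj_single_side bV cD d1 vDV).
have /setDP[x0C' x0V] := x0C.
pose s := [:: v; u; x0].
have neuv : v != u by apply: contraNneq vV => ->.
have nevx : v != x0 by apply: contraTneq vD => ->; apply: nCD.
have neux : u != x0 by apply: contraNneq x0V => <-.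
have us : uniq s by rewrite /= !inE negb_or neuv nevx neux.
have dom x : x \notin s -> exists2 y, y \in s & adj x y.
  rewrite !inE !negb_or => /and3P[nxv nxu nxx].
  have [xV|xV] := boolP (x \in V); have [xC|xD] := CD x.
  - by exists x0; rewrite ?inE ?eqxx ?orbT // adj_sym domx // inE xC.
  - by exists v; rewrite ?inE ?eqxx //; apply: adjv; rewrite inE xD.
  - by exists u; rewrite ?inE ?eqxx ?orbT // adj_sym domu // inE xC xV.
  by case/eqP: nxv; apply: (card1_eq d1); rewrite // inE xD xV.
suff <- : [seq pend [set x in s] y | y <- s] =
    [:: #|D :&: V|; #|C :\: V|.-1; #|C :&: V|.-1].
  by apply: tree_caterpillar; rewrite // /= adj_sym uv domu.
have -> : #|C :\: V|.-1 = #|(C :\: V) :\ x0| by rewrite [in LHS](cardsD1 x0) x0C.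
have -> : #|C :&: V|.-1 = #|(C :&: V) :\ u| by rewrite [in LHS](cardsD1 u) uCV.
rewrite /=; congr [:: _; _; _].
- apply: pend_eq => x; rewrite !inE ?negb_or.
    case/and3P=> nxv nxu _ xv.
    rewrite (nbr_side bV (_ : adj v x)) 1?adj_sym // vV andbT.
    by have [xC|//] := CD x; case/eqP: nxu; case: (cross x v xC vD xv).
  case/andP=> xD xV; rewrite adjv ?inE ?xD ?xV //; split=> //; apply/and3P; split.
  + by apply: contraNneq vV => <-.
  + by apply: contraTneq xD => ->; apply: nCD.
  by apply: contraTneq xD => ->; apply: nCD.
- apply: pend_eq => x; rewrite !inE ?negb_or.
    case/and3P=> nxv nxu -> xu.
    rewrite (nbr_side bV (_ : adj u x)) 1?adj_sym // uV /=.
    have [//|xD] := CD x; rewrite adj_sym in xu.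
    by case/eqP: nxv; case: (cross u x uC xD xu).
  case/and3P=> -> xV xC; rewrite adj_sym domu ?inE ?xC ?xV // andbT.
  split=> //; apply/andP; split.
    by apply: contraTneq vD => <-; apply: nCD.
  by apply: contraNneq xV => ->.
apply: pend_eq => x; rewrite !inE ?negb_or.
  case/and3P=> nxv -> nxx xx.
  rewrite (nbr_side bV (_ : adj x0 x)) 1?adj_sym // x0V andbT /=.
  have [//|xD] := CD x; rewrite adj_sym in xx.
  by case/eqP: nxv; case: (cross x0 x x0C' xD xx).
case/and3P=> -> xC xV; rewrite adj_sym domx ?inE ?xC ?xV //=.
split=> //; apply/andP; split.
  by apply: contraTneq vD => <-; apply: nCD.
by apply: contraNneq x0V => <-.
Qed.

(** If v is not the only vertex of its class on its side, the bound is strict.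
    Otherwise equality forces u and some x0 in C to be adjacent to the whole
    opposite classes within C, so that v, u, x0 form the spine of a caterpillar;
    moreover one of its two end weights is 1.  The right-hand side is
    16 F + 16 for the caterpillar [p - 2; q - 2; 1]. *)
Lemma lopsided_bound V C D u v : is_tree G -> bipartition V ->
  bridge C D u v -> C :|: D = setT -> connected_set C -> connected_set D ->
  u \in V -> v \notin V -> 1 < #|C :&: V| -> 0 < #|C :\: V| -> 0 < #|D :&: V| ->
  let p := #|V| in let q := #|~: V| in
  16 * F G + 16 <= 3 * (2 ^ p * 2 ^ q) + 12 * 2 ^ q + 4 * 2 ^ p + 16 * (p + q) /\
  (16 * F G + 16 = 3 * (2 ^ p * 2 ^ q) + 12 * 2 ^ q + 4 * 2 ^ p + 16 * (p + q) ->
   caterpillar [:: p - 2; q - 2; 1] G).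
Proof.
move=> tG bV br eT cC cD uV vV a2 b1 c1 p q; have [dCD uC vD uv cross] := br.
have C0 : C != set0 by apply/set0Pn; exists u.
have D0 : D != set0 by apply/set0Pn; exists v.
have [IC eqC] := subtree_bound tG bV cC C0.
have [ID _] := subtree_bound tG bV cD D0.
have [RC eqR] := rooted_bound tG bV cC uC uV.
have vV' : v \in ~: V by rewrite inE.
have [RD _] := rooted_bound tG (bipartitionC bV) cD vD vV'.
rewrite -setDE setDE setCK in RD.
have [||N2 E2] := mul_bounds _ _ RC RD; rewrite ?muln_gt0 ?expn_gt0 ?addn_gt0 ?orbT //.
have [N6 E6] := bridge_cross_bound IC ID N2.
rewrite -(bridge_wsub _ br) eT -F_wsub in N6 E6.
have cV : p = #|C :&: V| + #|D :&: V| by rewrite -cardsIU // eT setTI.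
have cV' : q = #|C :\: V| + #|D :\: V| by rewrite -cardsDU // eT setTD.
have A4 : 4 <= 2 ^ #|C :&: V| by rewrite -[4]/(2 ^ 2) leq_exp2l.
have B2 : 2 <= 2 ^ #|C :\: V| by rewrite -[2 in X in X <= _]/(2 ^ 1) leq_exp2l.
have C2 : 2 <= 2 ^ #|D :&: V| by rewrite -[2 in X in X <= _]/(2 ^ 1) leq_exp2l.
rewrite -cV -cV' in N6 E6.
have vDV : v \in D :\: V by rewrite inE vV.
have [d1|d1] := eqVneq #|D :\: V| 1; last first.
  have D4 : 4 <= 2 ^ #|D :\: V|.
    rewrite -[4]/(2 ^ 2) leq_exp2l // ltn_neqAle eq_sym d1 card_gt0; apply/set0Pn; by exists v.
  have N5 := cross_bound_lt_lopsided A4 B2 C2 D4.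
  rewrite -!expnD -cV -cV' expnD in N5.
  have [le eq] := cross_bound_lopsided N6 (ltnW N5).
  by split=> // /eq[_ eX]; move: N5; rewrite -eX ltnn.
have e2 : 2 ^ #|D :\: V| = 2 by rewrite d1.
have [N4 E4] := cross_bound_le_lopsided A4 B2 C2 e2.
rewrite -!expnD -cV -cV' expnD in N4 E4.
have [le eq] := cross_bound_lopsided N6 N4.
split=> // /eq[/E6[eWC exy] /E4 eAC].
have [eRC _] := E2 exy.
have [|x0 x0C domx] := eqC eWC; first by rewrite -card_gt0.
have cat := spine3_caterpillar tG bV br eT cD uV vV d1 x0C (eqR eRC) domx.
have -> : q - 2 = #|C :\: V|.-1 by rewrite cV' d1 addn1 subn2.
case: eAC => [eA|eC].
  have a : #|C :&: V| = 2 by apply/eqP; rewrite -(eqn_exp2l (m := 2)) // eA.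
  by move: cat; rewrite cV a addKn.
have c : #|D :&: V| = 1 by apply/eqP; rewrite -(eqn_exp2l (m := 2)) // eC.
by move: cat; rewrite cV c addn1 subn2 /= => /(caterpillar_rev tG)-/(_ isT).
Qed.

Lemma second_bound V p q : is_tree G -> bipartition V ->
  #|V| = p -> #|~: V| = q -> 1 < p -> 1 < q ->
  [\/ caterpillar [:: p.-1; q.-1] G,
    2 < p /\
    16 * F G + 16 <= 3 * (2 ^ p * 2 ^ q) + 12 * 2 ^ q + 4 * 2 ^ p + 16 * (p + q) /\
    (16 * F G + 16 = 3 * (2 ^ p * 2 ^ q) + 12 * 2 ^ q + 4 * 2 ^ p + 16 * (p + q) ->
     caterpillar [:: p - 2; q - 2; 1] G)
  | 2 < q /\
    16 * F G + 16 <= 3 * (2 ^ q * 2 ^ p) + 12 * 2 ^ p + 4 * 2 ^ q + 16 * (q + p) /\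
    (16 * F G + 16 = 3 * (2 ^ q * 2 ^ p) + 12 * 2 ^ p + 4 * 2 ^ q + 16 * (q + p) ->
     caterpillar [:: q - 2; p - 2; 1] G)].
Proof.
move=> tG bV cV cV' p1 q1.
have cT := tree_connected_setT tG.
have [||u [v [uS vS uv [x xS ux] [y yS vy]]]] := internal_edge bV cT.
- by rewrite setTI cV.
- by rewrite setTD cV'.
have [C [D [eT br cC cD]]] := tree_bridge tG cT (in_setT u) (in_setT v) uv.
have [dCD uC vD _ cross] := br.
have uV : u \in V by case/setIP: uS.
have vV : v \notin V by case/setDP: vS.
have b1 : 0 < #|C :\: V|.
  case/setD1P: xS => nexv /setDP[_ xV]; apply/card_gt0P; exists x.
  rewrite inE xV; have := in_setT x; rewrite eT inE => /orP[//|xD].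
  by case/eqP: nexv; case: (cross u x uC xD ux).
have c1 : 0 < #|D :&: V|.
  case/setD1P: yS => neyu /setIP[_ yV]; apply/card_gt0P; exists y.
  rewrite inE yV andbT; have := in_setT y; rewrite eT inE => /orP[yC|//].
  rewrite adj_sym in vy.
  by case/eqP: neyu; case: (cross y v yC vD vy).
have a1 : 0 < #|C :&: V| by apply/card_gt0P; exists u; rewrite inE uC.
have d1 : 0 < #|D :\: V| by apply/card_gt0P; exists v; rewrite inE vV.
have pE : p = #|C :&: V| + #|D :&: V| by rewrite -cV -cardsIU // -eT setTI.
have qE : q = #|C :\: V| + #|D :\: V| by rewrite -cV' -cardsDU // -eT setTD.
have [a2|] := ltnP 1 #|C :&: V|.
  have := lopsided_bound tG bV br (esym eT) cC cD uV vV a2 b1 c1.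
  rewrite cV cV' => H; apply: Or32; split=> //.
  by rewrite pE -[3]/(2 + 1) leq_add.
have [d2 _|d2 a2] := ltnP 1 #|D :\: V|.
  have := lopsided_bound (V := ~: V) tG (bipartitionC bV) (bridge_sym br).
  rewrite -!setDE !setDE !setCK -!setDE setUC cV' cV !inE uV => H.
  apply: Or33; split; first by rewrite qE -[3]/(1 + 2) leq_add.
  exact: H.
apply: Or31; rewrite -cV -cV'.
apply: (double_star_caterpillar tG bV br) => //.
  by apply/eqP; rewrite eqn_leq a2.
by apply/eqP; rewrite eqn_leq d2.
Qed.

End SecondBound.

(** * Lower bounds in terms of the pendant vertices *)

(** With X = 2^x, U = 2^u and T = 2^d, where x + d <= u, this compares the exponents
    x + d and u with the more spread out x and u + d. *)
Lemma spread_le X U T : 0 < X -> 1 <= T -> X * T <= U ->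
  T * X + U <= X + U * T /\ (T * X + U = X + U * T -> T = 1).
Proof.
move=> X0 /leq_exists[t ->] /leq_exists[r ->].
have -> : X + (r + X * (t + 1)) * (t + 1) =
  (t + 1) * X + (r + X * (t + 1)) + t * (r + X * t) by ring.
split=> [|e]; first exact: leq_addr.
have /eqP : t * (r + X * t) = 0.
  by apply: (@addnI ((t + 1) * X + (r + X * (t + 1)))); rewrite addn0 -e.
rewrite muln_eq0 addn_eq0 muln_eq0 (gtn_eqF X0) /= => t0.
by have -> : t = 0 by case/orP: t0 => [/eqP//|/andP[_ /eqP]].
Qed.

Lemma balanced_exp k x y : x + y = k ->
  2 ^ k./2 + 2 ^ uphalf k <= 2 ^ x + 2 ^ y /\
  (2 ^ k./2 + 2 ^ uphalf k = 2 ^ x + 2 ^ y ->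
    x = k./2 /\ y = uphalf k \/ x = uphalf k /\ y = k./2).
Proof.
wlog le_xy : x y / x <= y => [W|].
  have [le|/ltnW le] := leqP x y; first exact: W.
  rewrite addnC => /(W _ _ le); rewrite addnC [2 ^ y + _]addnC => -[le2 eq].
  split=> // /eq [[-> ->]|[-> ->]]; [by right|by left].
move=> exy; have leh : x <= k./2 by lia.
pose d := k./2 - x.
have eh : k./2 = d + x by rewrite subnK.
have ey : y = uphalf k + d by lia.
have hU : 2 ^ x * 2 ^ d <= 2 ^ uphalf k by rewrite -expnD leq_exp2l; lia.
have T0 : 1 <= 2 ^ d by rewrite expn_gt0.
have X0 : 0 < 2 ^ x by rewrite expn_gt0.
have [le eq] := spread_le X0 T0 hU.
rewrite ey eh !expnD; split=> // /eq/eqP.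
rewrite -[X in _ == X](expn0 2) eqn_exp2l // => /eqP d0.
by left; rewrite d0 add0n addn0.
Qed.

Lemma sub_step u t n : u < t -> t - u <= n -> t - u.+1 < n.
Proof. lia. Qed.

Lemma sub_step_le u t a e r : u < t -> 0 < e -> a + (t - u.+1) <= r ->
  a + (t - u) <= e + r.
Proof. lia. Qed.

Lemma tight_le1 e r a t : 1 < t -> e + r <= a + t.-1 -> a + (t - 2) <= r -> e <= 1.
Proof. lia. Qed.

Section Chains.
Variable G : sgraph.
Implicit Types (A B C D S T U V L : {set G}) (u v x y z : G) (w : G -> nat) (s : seq G).

Lemma connected_extend U S : connected_set U -> connected_set S ->
  U != set0 -> U \proper S ->
  exists2 x, x \in S :\: U & connected_set (x |: U).
Proof.
move=> cU cS U0 /andP[sU nS].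
have [||x [y [xU yS xy]]] := connected_setP S cS U sU => //.
  by apply: contraNneq nS => ->.
exists y => //; rewrite adj_sym in xy.
by apply: connected_setU xy; rewrite ?connected_set1 ?inE.
Qed.

(** Enlarge U one vertex at a time; the last vertex added is the one sought. *)
Lemma connected_leaf U S : connected_set U -> connected_set S ->
  U != set0 -> U \proper S ->
  exists2 x, x \in S :\: U & connected_set (S :\ x).
Proof.
move=> cU cS; have [n] := ubnP (#|S| - #|U|); elim: n => // n IHn in U cU *.
rewrite ltnS => le U0 pU; have [x /setDP[xS xU] cxU] := connected_extend cU cS U0 pU.
have [exU|nexU] := eqVneq (x |: U) S.
  by exists x; rewrite ?inE ?xU // -exU setU1K.
have [|||y] := IHn _ cxU.
- have := proper_card pU; rewrite cardsU1 xU /= add1n => lt.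
  by rewrite subnS -ltnS prednK ?(leq_ltn_trans le) // subn_gt0.
- by apply/set0Pn; exists x; rewrite !inE eqxx.
- by rewrite properEneq nexU subUset sub1set xS proper_sub.
by rewrite !inE negb_or => /andP[/andP[_ yU] yS] cy; exists y; rewrite // inE yU.
Qed.

Lemma leaf_bridge S x : is_tree G -> connected_set S -> x \in S ->
  connected_set (S :\ x) -> S :\ x != set0 ->
  exists2 v, v \in S :\ x & bridge [set x] (S :\ x) x v.
Proof.
move=> tG cS xS cS' S0.
have [|v vS xv] := connected_nbr cS xS.
  by apply: contraNneq S0 => {1}->; rewrite setDv.
have vS' : v \in S :\ x.
  by rewrite !inE vS andbT; apply: contraTneq xv => ->; rewrite adj_irr.
exists v => //; split; rewrite ?inE ?eqxx // ?disjoints1 ?inE ?eqxx //.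
  by have := vS'; rewrite !inE.
move=> a y; rewrite inE => /eqP-> yS xy; split=> //.
by apply: (tree_adj1 tG cS' _ yS vS' xy xv); rewrite !inE eqxx.
Qed.

Definition wsub_above w S U :=
  \sum_(A in subtrees G | (A \subset S) && (U \subset A)) 2 ^ wt w A.

Lemma wsub_at_above w S v : wsub_at w S v = wsub_above w S [set v].
Proof. by apply: eq_bigl => A; rewrite sub1set. Qed.

Lemma above_cons w S U T : connected_set U -> U != set0 -> U \subset S ->
  U \proper T -> 2 ^ wt w U + wsub_above w S T <= wsub_above w S U.
Proof.
move=> cU U0 sU pT; rewrite [X in _ <= X](bigD1 U) /=; last first.
  by rewrite inE U0 cU sU subxx.
rewrite leq_add2l /wsub_above [X in _ <= X](bigID (fun A => T \subset A)) /=.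
apply: leq_trans (leq_addr _ _); rewrite leq_eqVlt; apply/orP; left; apply/eqP.
apply: eq_bigl => A; rewrite -!andbA; congr (_ && (_ && _)).
have [TA|] := boolP (T \subset A); rewrite ?andbF // andbT.
rewrite (subset_trans (proper_sub pT) TA) /=; apply/esym.
by apply: contraTneq pT => <-; rewrite properE TA andbF.
Qed.

(** A chain of connected sets that grows from U to S by one vertex at a time
    contributes at least 1 for each of its members other than S. *)
Lemma above_ge w S U : connected_set U -> connected_set S -> U != set0 ->
  U \subset S -> 2 ^ wt w S + (#|S| - #|U|) <= wsub_above w S U.
Proof.
move=> cU cS; have [n] := ubnP (#|S| - #|U|); elim: n => // n IHn in U cU *.
rewrite ltnS => le U0 sU; have [eU|neU] := eqVneq U S.
  rewrite eU subnn addn0 /wsub_above (bigD1 S) /= ?leq_addr //.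
  by rewrite inE -{1}eU U0 cS subxx.
have pU : U \proper S by rewrite properEneq neU.
have [x /setDP[xS xU] cxU] := connected_extend cU cS U0 pU.
have pxU : U \proper x |: U.
  by rewrite properE subsetUr; apply/subsetPn; exists x; rewrite // !inE eqxx.
apply: leq_trans (above_cons w cU U0 sU pxU).
have lt := proper_card pU.
have cx : #|x |: U| = #|U|.+1 by rewrite cardsU1 xU.
have IH : 2 ^ wt w S + (#|S| - #|x |: U|) <= wsub_above w S (x |: U).
  apply: IHn cxU _ _ _.
  - by rewrite cx; apply: sub_step.
  - by apply/set0Pn; exists x; rewrite !inE eqxx.
  - by rewrite subUset sub1set xS.
by rewrite cx in IH; apply: sub_step_le IH; rewrite // expn_gt0.
Qed.

Lemma wsub_at_ge w S v : connected_set S -> v \in S ->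
  2 ^ wt w S + (#|S|.-1) <= wsub_at w S v.
Proof.
move=> cS vS; rewrite wsub_at_above.
have v0 : [set v] != set0 by apply/set0Pn; exists v; rewrite inE.
have := above_ge w (connected_set1 v) cS v0; rewrite sub1set cards1 subn1.
exact.
Qed.

(** In the case of equality the chain from {v} to S contains all the connected sets
    through v, and those other than S have weight 0.  So {v} has weight 0, and a
    second neighbour z of v would give the extra set {v, z}. *)
Lemma wsub_at_eq w S v : connected_set S -> v \in S -> 1 < #|S| ->
  wsub_at w S v = 2 ^ wt w S + (#|S|.-1) ->
  w v = 0 /\ {in S &, forall y z, adj v y -> adj v z -> y = z}.
Proof.
move=> cS vS S1; rewrite wsub_at_above => e.
have v0 : [set v] != set0 by apply/set0Pn; exists v; rewrite inE.
have pair_set y : y \in S -> adj v y ->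
    [/\ connected_set [set v; y], [set v; y] \subset S, [set v] \proper [set v; y] &
        #|[set v; y]| = 2].
  move=> yS vy; have nevy : v != y by apply: contraTneq vy => ->; rewrite adj_irr.
  split; rewrite ?cards2 ?nevy //.
  - by apply: connected_setU vy; rewrite ?connected_set1 ?inE.
  - by rewrite subUset !sub1set vS.
  rewrite properE subsetUl; apply/subsetPn; exists y; rewrite !inE ?eqxx ?orbT //.
  by rewrite eq_sym.
have neS : S != [set v] by apply: contraTneq S1 => ->; rewrite cards1.
have [y yS vy] := connected_nbr cS vS neS.
have [cvy svy pvy n2] := pair_set y yS vy.
have vy0 : [set v; y] != set0 by apply/set0Pn; exists v; rewrite !inE eqxx.
have vS1 : [set v] \subset S by rewrite sub1set.
have h1 := above_cons w (connected_set1 v) v0 vS1 pvy.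
have h2 := above_ge w cvy cS vy0 svy.
have wtv : wt w [set v] = w v by rewrite /wt big_set1.
rewrite n2 in h2; rewrite e wtv in h1; split.
  have := tight_le1 S1 h1 h2.
  by rewrite -[X in _ <= X](expn0 2) leq_exp2l // leqn0 => /eqP.
suff uniq_nbr z : z \in S -> adj v z -> z = y.
  by move=> a b aS bS /(uniq_nbr a aS)-> /(uniq_nbr b bS)->.
move=> zS vz; apply/eqP/negPn/negP=> nezy.
have [cvz svz pvz _] := pair_set z zS vz.
have nsub : ~~ ([set v; y] \subset [set v; z]).
  apply/subsetPn; exists y; rewrite !inE ?eqxx ?orbT // negb_or [y == z]eq_sym nezy.
  by rewrite andbT; apply: contraTneq vy => ->; rewrite adj_irr.
suff : 2 ^ wt w [set v] + 2 ^ wt w [set v; z] + wsub_above w S [set v; y] <= 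
    wsub_above w S [set v].
  rewrite e => h3; have := tight_le1 S1 h3 h2.
  by apply/negP; rewrite -ltnNge; apply: (@leq_add 1 1); rewrite expn_gt0.
rewrite [X in _ <= X](bigD1 [set v]) /=; last first.
  by rewrite inE v0 connected_set1 vS1 subxx.
rewrite -addnA leq_add2l (bigD1 [set v; z]) /=; last first.
  have vz0 : [set v; z] != set0 by apply/set0Pn; exists v; rewrite !inE eqxx.
  by rewrite inE vz0 cvz svz (proper_sub pvz) eq_sym (proper_neq pvz).
rewrite leq_add2l /wsub_above [X in _ <= X](bigID (fun A => [set v; y] \subset A)) /=.
apply: leq_trans (leq_addr _ _); rewrite leq_eqVlt; apply/orP; left; apply/eqP.
apply: eq_bigl => A; rewrite -!andbA; congr (_ && (_ && _)).
have [TA|] := boolP ([set v; y] \subset A); rewrite ?andbF // andbT.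
rewrite (subset_trans (proper_sub pvy) TA) /=; apply/esym/andP; split.
  by apply: contraTneq TA => ->; have /andP[] := pvy.
by apply: contraNneq nsub => <-.
Qed.

End Chains.

(** The weights along the spine of P_m(a, b); for m = 1 both groups of pendant
    vertices hang at the only spine vertex. *)
Definition dumbbell m a b :=
  if m is m'.+2 then a :: rcons (nseq m' 0) b else [:: a + b].

Definition min_weight m k :=
  2 ^ k + m.-1 * (2 ^ k./2 + 2 ^ uphalf k) + 'C(m.-1, 2).

Lemma min_weightS m k : min_weight m.+2 k =
  min_weight m.+1 k + (2 ^ k./2 + 2 ^ uphalf k) + m.
Proof. by rewrite /min_weight /= binS bin1; set X := _ + 2 ^ uphalf k; ring. Qed.

Lemma min_step_arith W f X Y M r m a :
  M <= W -> r <= X + Y -> Y + m <= f -> a = W + X + f ->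
  M + r + m <= a /\ (M + r + m = a -> [/\ M = W, r = X + Y & f = Y + m]).
Proof. by move=> h1 h2 h3 ->; split=> [|e]; [lia|split; lia]. Qed.

Section PathBound.
Variable G : sgraph.
Implicit Types (A B C D S U V L : {set G}) (u v x y z : G) (w : G -> nat) (s : seq G).

Lemma end_of_path s v : uniq s -> sorted (@adj G) s -> v \in s ->
  {in s &, forall y z, adj v y -> adj v z -> y = z} ->
  (exists t, s = v :: t) \/ (exists t, s = rcons t v).
Proof.
move=> us ss vs nbr; case/splitPr: vs us ss nbr => s1 s2.
case/lastP: s1 => [_ _ _|s1 a]; first by left; exists s2.
case: s2 => [_ _ _|b s2]; first by right; exists (rcons s1 a); rewrite -[RHS]cats1.
move=> us ss nbr; have av : adj v a.
  move: ss; rewrite cat_rcons sorted_cat_cons => /andP[_] /= /and3P[av _ _].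
  by rewrite adj_sym.
have vb : adj v b.
  move: ss; rewrite cat_rcons sorted_cat_cons => /andP[_] /= /and3P[_ vb _].
  by [].
have eab : a = b.
  by apply: nbr; rewrite ?mem_cat ?mem_rcons ?inE ?eqxx ?orbT.
move: us; rewrite cat_uniq => /and3P[_ /hasPn/(_ b)].
by rewrite !inE eqxx orbT mem_rcons inE eab eqxx => /(_ isT).
Qed.

(** Induction on the size of S: contract a pendant edge xv as in [wsub_push].  The
    term 2^w(x) together with the lower bound on the number of sets through v is
    minimized by a balanced split of the weight.  In the case of equality the rest
    is a path with weights at its ends, and x extends it: unless v is the whole
    rest, it has weight 0 and only one neighbour there, so it is an end of the path. *)
Lemma min_bound w S : is_tree G -> connected_set S -> S != set0 ->
  min_weight #|S| (wt w S) <= wsub w S /\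
  (min_weight #|S| (wt w S) = wsub w S ->
   exists s, [/\ uniq s, sorted (@adj G) s, [set x in s] = S &
     exists a b, map w s = dumbbell #|S| a b /\
       (a = (wt w S)./2 /\ b = uphalf (wt w S) \/
        a = uphalf (wt w S) /\ b = (wt w S)./2)]).
Proof.
move=> tG; have [n] := ubnP #|S|; elim: n => // n IHn in w S *.
rewrite ltnS => le cS /set0Pn[u uS].
have [eS|neS] := eqVneq S [set u].
  rewrite eS cards1 /wt big_set1 wsub_set1 /min_weight /= mul0n !addn0; split=> // _.
  exists [:: u]; split=> //; first by apply/setP=> x; rewrite !inE.
  exists (w u)./2, (uphalf (w u)); split; last by left.
  by rewrite /= uphalf_half addnCA addnn odd_double_half.
have u0 : [set u] != set0 by apply/set0Pn; exists u; rewrite inE.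
have pu : [set u] \proper S by rewrite properEneq eq_sym neS sub1set.
have [x /setDP[xS nxu] cS'] := connected_leaf (connected_set1 u) cS u0 pu.
have S0 : S :\ x != set0.
  apply/set0Pn; exists u; rewrite !inE uS andbT.
  by apply: contraNneq nxu => ->; rewrite inE.
have [v vS br] := leaf_bridge tG cS xS cS' S0.
have eS := setD1K xS; set S' := S :\ x in cS' S0 vS br eS.
have cardS : #|S| = #|S'|.+1 by rewrite (cardsD1 x) xS.
have wtS : wt w S = w x + wt w S' by rewrite /wt (big_setD1 x).
set k := wt w S in wtS *.
have wtS' : wt (add_wt v (w x) w) S' = k by rewrite wt_add vS mul1n wtS addnC.
have le' : #|S'| < n by rewrite -cardS.
have [IH eqIH] := IHn (add_wt v (w x) w) S' le' cS' S0; rewrite wtS' in IH eqIH.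
have f_ge := wsub_at_ge w cS' vS.
have [bal eqbal] := balanced_exp (esym wtS).
have c0 : 0 < #|S'| by rewrite card_gt0.
rewrite cardS -(prednK c0) min_weightS (prednK c0).
have [le1 eq1] := min_step_arith IH bal f_ge (wsub_push w br).
rewrite -eS; split=> // /eq1[/eqIH[s [us ss es [a [b [ews ab]]]]] /eqbal bxy ef] {eq1}.
have xs : x \notin s by move/setP/(_ x): es; rewrite /S' !inE eqxx => ->.
have xv : adj x v by case: br.
have svs : v \in s by move: vS; rewrite -es inE.
have [S1|] := ltnP 1 #|S'|; last first.
  move=> S1; have /cards1P[z ez] : #|S'| == 1 by rewrite eqn_leq S1.
  have ezv : v = z by move: vS; rewrite ez inE => /eqP.
  exists [:: x; v]; split.
  - by rewrite /= inE andbT; apply: contraNneq xs => ->.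
  - by rewrite /= xv.
  - by rewrite ez ezv; apply/setP=> y; rewrite !inE.
  exists (w x), (w v); rewrite ez cards1 /=; split=> //.
  move: bxy; rewrite ez /wt big_set1 ezv.
  by case=> [[-> ->]|[-> ->]]; [left|right].
have [wv nbr] := wsub_at_eq cS' vS S1 ef.
have e_wt y : y \in s -> y != v -> add_wt v (w x) w y = w y.
  by move=> _ /negPf nyv; rewrite /add_wt nyv mul0n addn0.
have e_wtv : add_wt v (w x) w v = w x by rewrite /add_wt eqxx mul1n wv.
have setxs : [set y in x :: s] = x |: S'.
  by rewrite -es; apply/setP=> y; rewrite !inE.
have [t et] : exists t, #|S'| = t.+2 by case: #|S'| S1 => [|[|t]] // _; exists t.
rewrite et in ews *.
have nbr' : {in s &, forall y z, adj v y -> adj v z -> y = z}.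
  by move=> y z ys zs; apply: nbr; rewrite -es inE.
case: (end_of_path us ss svs nbr') => -[r er].
  exists (x :: s); split=> //=; rewrite ?xs //.
    by move: ss; rewrite er /= xv.
  exists a, b; split=> //; move: ews; rewrite er /= e_wtv wv => -[<- <-].
  congr [:: _, _ & _]; apply/eq_in_map => y yr; rewrite e_wt ?er ?inE ?yr ?orbT //.
  by apply: contraTneq yr => ->; move: us; rewrite er /= => /andP[].
exists (rcons s x); split.
- by rewrite rcons_uniq xs.
- rewrite er; case: r er => [|c r] er; first by rewrite /= adj_sym xv.
  by move: ss; rewrite er /= [in X in _ -> X]rcons_path last_rcons adj_sym xv => ->.
- by rewrite -setxs; apply/setP=> y; rewrite !inE mem_rcons inE.
exists a, b; split=> //; move: ews; rewrite er !map_rcons /= e_wtv wv.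
rewrite -rcons_cons => /rcons_inj[er2 ->].
rewrite (_ : map w r = a :: nseq t 0); last first.
  rewrite -er2; apply/eq_in_map => y yr; rewrite e_wt ?er ?mem_rcons ?inE ?yr ?orbT //.
  by apply: contraTneq yr => ->; move: us; rewrite er rcons_uniq => /andP[].
have e0 : rcons (nseq t 0) 0 = nseq t.+1 0.
  by rewrite -cats1 -[[:: 0]]/(nseq 1 0) -nseqD addn1.
by rewrite /= e0.
Qed.

End PathBound.

Lemma rev_dumbbell m a b : rev (dumbbell m a b) = dumbbell m b a.
Proof.
case: m => [|[|m]]; rewrite /= 1?addnC //.
by rewrite rev_cons rev_rcons rev_nseq.
Qed.

Section PendantBound.
Variable G : sgraph.
Implicit Types (A B C D S U V L : {set G}) (u v x y z : G) (w : G -> nat) (s : seq G).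

Definition branching V S := [set y in S :\: V | 1 < #|[set z in S | adj y z]|].

(** Remove leaves of S other than r one by one.  A removed vertex of V lowers the
    right-hand side by one, and only its neighbour can cease to be branching;
    removing a vertex outside V changes the degree of no other vertex outside V. *)
Lemma card_branching V S r : is_tree G -> bipartition V -> connected_set S ->
  r \in S :&: V -> #|branching V S| < #|S :&: V|.
Proof.
move=> tG bV; have [n] := ubnP #|S|; elim: n => // n IHn in S *.
rewrite ltnS => le cS rSV; have /setIP[rS rV] := rSV.
have [eS|neS] := eqVneq S [set r].
  rewrite (_ : branching V S = set0) ?cards0; first by apply/card_gt0P; exists r.
  apply/setP=> y; rewrite !inE eS !inE.
  by case: (eqVneq y r) => [->|_]; rewrite ?rV ?andbF.
have r0 : [set r] != set0 by apply/set0Pn; exists r; rewrite inE.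
have pr : [set r] \proper S by rewrite properEneq eq_sym neS sub1set.
have [x /setDP[xS nxr] cS'] := connected_leaf (connected_set1 r) cS r0 pr.
have rS' : r \in S :\ x by rewrite !inE rS andbT; apply: contraNneq nxr => ->; rewrite inE.
have S0 : S :\ x != set0 by apply/set0Pn; exists r.
have [v vS br] := leaf_bridge tG cS xS cS' S0.
have lt : #|S :\ x| < n by rewrite (cardsD1 x) xS in le.
have rSV' : r \in (S :\ x) :&: V by rewrite inE rS'.
have IH := IHn _ lt cS' rSV'.
have [_ _ _ xv cross] := br.
have only z : z \in S -> adj x z -> z = v.
  move=> zS xz; have [||_ ->//] := cross x z _ _ xz; rewrite !inE ?zS ?andbT //.
  by apply: contraTneq xz => ->; rewrite adj_irr.
have [xV|xV] := boolP (x \in V).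
  have -> : #|S :&: V| = #|(S :\ x) :&: V|.+1.
    rewrite (cardsD1 x) inE xS xV add1n; congr _.+1; apply: eq_card => z.
    by rewrite !inE andbA.
  rewrite ltnS; apply: leq_trans IH.
  apply: leq_trans (_ : #|v |: branching V (S :\ x)| <= _); last first.
    by rewrite cardsU1 -add1n leq_add2r leq_b1.
  apply: subset_leq_card; apply/subsetP=> y; rewrite !inE => /andP[/andP[yV yS] y2].
  case: eqVneq => //= nyv; rewrite yV yS andbT.
  rewrite (_ : y != x) /=; last by apply: contraNneq yV => ->.
  rewrite (leq_trans y2) // subset_leq_card //; apply/subsetP=> z.
  rewrite !inE => /andP[zS yz]; rewrite zS yz !andbT.
  apply: contraNneq nyv => ezx; apply/eqP; apply: only => //.
  by rewrite adj_sym -ezx.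
have -> : #|S :&: V| = #|(S :\ x) :&: V|.
  apply: eq_card => z; rewrite !inE; case: (eqVneq z x) => [->|//].
  by rewrite (negPf xV) andbF.
apply: leq_ltn_trans IH; apply: subset_leq_card; apply/subsetP=> y.
rewrite !inE => /andP[/andP[yV yS] y2].
rewrite yV yS andbT /=; have [eyx|nyx] := eqVneq y x.
  move: y2; rewrite ltnNge -(cards1 v) subset_leq_card //; apply/subsetP=> z.
  by rewrite !inE eyx => /andP[zS /(only z zS)->].
rewrite (leq_trans y2) //= subset_leq_card //; apply/subsetP=> z.
rewrite !inE => /andP[zS yz]; rewrite zS yz !andbT.
have zV : z \in V by rewrite (nbr_side bV yz).
by apply: contraTneq zV => ->.
Qed.

Lemma subset_of_card (X : {set G}) k : k <= #|X| ->
  exists2 L : {set G}, L \subset X & #|L| = k.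
Proof.
move=> le; exists [set x in take k (enum X)].
  by apply/subsetP=> x; rewrite inE => /mem_take; rewrite mem_enum.
rewrite cardsE (card_uniqP _) ?take_uniq ?enum_uniq //.
by rewrite size_take -cardE; case: ltngtP le.
Qed.

(** Given a cut of the complement of L, put every vertex of L on the side of its
    neighbour: no edge at L crosses the resulting cut. *)
Lemma connected_setC_pendants L : connected_set [set: G] ->
  {in L, forall x, exists2 y, y \in ~: L & forall z, adj x z = (z == y)} ->
  connected_set (~: L).
Proof.
move=> cT pL; apply/connected_setP=> B sB B0 neB.
pose B' := B :|: [set x in L | [exists y in B, adj x y]].
have BL x : x \in B -> x \notin L by move/(subsetP sB); rewrite inE.
have [|||a [b []]] := connected_setP _ cT B'.
- exact: subsetT.
- by case/set0Pn: B0 => z zB; apply/set0Pn; exists z; rewrite inE zB.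
- apply: contraNneq neB => eB; rewrite eqEsubset sB; apply/subsetP=> z.
  have := in_setT z; rewrite -eB !inE => /orP[->//|/andP[->]].
  by [].
rewrite !inE negb_or => aB' /andP[/andP[bB nb] _] ab.
case/orP: aB' => [aB|/andP[aL /exists_inP[y yB ay]]].
  exists a, b; split=> //; rewrite !inE bB /=; apply: contra nb => ->.
  by apply/exists_inP; exists a; rewrite // adj_sym.
have [c _ ac] := pL a aL; move: ab ay; rewrite !ac => /eqP eb /eqP ey.
by rewrite eb -ey yB in bB.
Qed.

Lemma wt_pend S :
  (forall x, x \notin S -> exists2 y, y \in S & forall z, adj x z = (z == y)) ->
  wt (pend S) S = #|~: S|.
Proof.
move=> pS; rewrite /wt /pend.
rewrite (eq_bigr (fun y => \sum_(x in ~: S) (adj x y : nat))); last first.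
  move=> y _; rewrite -sum1_card big_mkcond [RHS]big_mkcond /=; apply: eq_bigr => x _.
  by rewrite !inE; case: (x \in S); case: (adj x y).
rewrite exchange_big /= -sum1_card; apply: eq_bigr => x; rewrite inE => /pS[y yS e].
rewrite (bigD1 y) //= e eqxx big1 // => z /andP[_ /negPf nz]; by rewrite e nz.
Qed.

Lemma min_caterpillar V p q : is_tree G -> bipartition V ->
  #|V| = p -> #|~: V| = q -> 0 < p -> p <= q ->
  let m := 2 * p - 1 in let k := q - p + 1 in
  k + min_weight m k <= F G /\
  (F G = k + min_weight m k -> caterpillar (dumbbell m k./2 (uphalf k)) G).
Proof.
move=> tG bV cV cV' p0 le_pq m k.
have cT := tree_connected_setT tG.
have [r rV] : exists r, r \in V by apply/card_gt0P; rewrite cV.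
have := card_branching (r := r) tG bV cT; rewrite setTI cV => /(_ rV) ltN.
(* X consists of the leaves in the larger class. *)
pose X := ~: V :\: branching V setT.
have kX : k <= #|X|.
  rewrite /X cardsD cV' (leq_trans _ (leq_sub2l _ (subset_leq_card (subsetIr _ _)))) //.
  by rewrite /k; move: ltN le_pq; set N := #|_|; clearbody N; lia.
have [L sLX cL] := subset_of_card kX.
have LV x : x \in L -> x \notin V.
  by move/(subsetP sLX); rewrite !inE => /andP[].
have pL : {in L, forall x, exists2 y, y \in ~: L & forall z, adj x z = (z == y)}.
  move=> x xL; have xV := LV x xL.
  have [|y _ xy] := connected_nbr cT (in_setT x).
    by apply: contraNneq xV => eT; have := in_setT r; rewrite eT inE => /eqP <-.
  have yV : y \in V by rewrite (nbr_side bV xy).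
  exists y; first by rewrite inE; apply: contraL yV => /LV.
  move=> z; apply/idP/eqP=> [xz|->//].
  have := subsetP sLX x xL; rewrite !inE xV /= andbT -leqNgt => le1.
  apply/eqP; apply: contraLR le1 => nezy; rewrite -ltnNge.
  rewrite (_ : 2 = #|[set z; y]|); last by rewrite cards2 nezy.
  by apply: subset_leq_card; apply/subsetP=> t; rewrite !inE => /orP[]/eqP->.
pose S := ~: L; have pS x : x \notin S -> exists2 y, y \in S & forall z, adj x z = (z == y).
  by rewrite inE negbK; apply: pL.
have cS : connected_set S by apply: connected_setC_pendants.
have S0 : S != set0 by apply/set0Pn; exists r; rewrite inE; apply: contraL rV => /LV.
have wS : wt (pend S) S = k by rewrite wt_pend // setCK.
have cardS : #|S| = m.
  have := cardsC L; have := cardsC V; rewrite cV cV' cL -/S => <-.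
  by rewrite /m /k; move: le_pq p0; set N := #|_|; clearbody N; lia.
have [le eq] := min_bound (pend S) tG cS S0; rewrite wS cardS in le eq.
rewrite (F_pendants pS) setCK cL leq_add2l; split=> // /addnI/esym/eq.
case=> s [us ss es [a [b [ews ab]]]].
have s0 : s != [::] by apply: contraNneq S0 => s0; rewrite -es s0; apply/eqP/setP=> x; rewrite !inE.
have dom x : x \notin s -> exists2 y, y \in s & adj x y.
  move=> xs; have [|y yS e] := pS x; first by rewrite -es inE.
  by exists y; rewrite ?e //; move: yS; rewrite -es inE.
have := tree_caterpillar tG us s0 ss dom; rewrite es ews.
case: ab => [[-> ->]//|[-> ->]] cat; rewrite -rev_dumbbell; apply: caterpillar_rev => //.
by case: (m) => [|[]].
Qed.

End PendantBound.

(** * The extremal trees are caterpillars *)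

Lemma card_set_sum (X Y : finType) (P : pred (X + Y)) :
  #|[set z | P z]| = #|[set x | P (inl x)]| + #|[set y | P (inr y)]|.
Proof.
rewrite -!sum1_card [LHS]big_mkcond big_sumType /=.
by congr (_ + _); rewrite [RHS]big_mkcond; apply: eq_bigr => x _; rewrite !inE.
Qed.

Section Attach.
Variables (G : sgraph) (s : seq G) (v : G) (k : nat).
Hypotheses (ips : induced_path s) (pds : pendant_outside s) (vs : v \in s).
Let s' : seq (attach v k) := [seq inl x | x <- s].

Lemma inl_inj (X Y : Type) : injective (@inl X Y).
Proof. by move=> x y []. Qed.

Lemma mem_inl x : ((inl x : attach v k) \in s') = (x \in s).
Proof. by rewrite mem_map //; apply: inl_inj. Qed.

Lemma attach_induced_path : induced_path s'.
Proof.
case: ips => us adjs; split; first by rewrite map_inj_uniq //; apply: inl_inj.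
move=> _ _ /mapP[x xs ->] /mapP[y ys ->]; rewrite !index_map; try exact: inl_inj.
exact: adjs.
Qed.

Lemma attach_pendant_outside : pendant_outside s'.
Proof.
move=> [x|i] xs; last by exists (inl v); rewrite ?mem_inl // => -[].
rewrite mem_inl in xs; have [y ys e] := pds xs.
exists (inl y); rewrite ?mem_inl // => -[z|i] /=; first by rewrite e.
by apply: contraNF xs => /eqP->.
Qed.

Lemma attach_pend y : y \in s ->
  pend [set x in s'] (inl y) = pend [set x in s] y + (y == v) * k.
Proof.
move=> ys; rewrite /pend card_set_sum; congr (_ + _).
  by apply: eq_card => x; rewrite !inE mem_inl.
have -> : [set i : 'I_k | (inr i \notin [set x in s']) &&
     adj (inr i : attach v k) (inl y)] = [set i : 'I_k | y == v].
  apply/setP=> i; rewrite !inE /= (_ : inr i \notin s') //.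
  by apply/negP=> /mapP[].
case: (y == v); last first.
  by rewrite mul0n; apply/eqP; rewrite cards_eq0; apply/eqP/setP=> i; rewrite !inE.
by rewrite mul1n cardsE card_ord.
Qed.

Lemma attach_pends : [seq pend [set x in s'] y | y <- s'] =
  [seq pend [set x in s] y + (y == v) * k | y <- s].
Proof. by rewrite -map_comp; apply/eq_in_map => y ys; rewrite /= attach_pend. Qed.

End Attach.

Lemma pend_setU1 (G : sgraph) (S : {set G}) x y : x \notin S ->
  pend S y = pend (x |: S) y + adj x y.
Proof.
move=> xS; rewrite /pend (cardsD1 x) !inE xS addnC; congr (_ + _).
by apply: eq_card => z; rewrite !inE negb_or andbA.
Qed.

Lemma star_spine p : 0 < p -> let s : seq (star p) := [:: ord0; ord_max] in
  [/\ induced_path s, pendant_outside s & [seq pend [set x in s] y | y <- s] = [:: p.-1; 0]].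
Proof.
move=> p0 s; have ne : (ord_max == ord0 :> 'I_p.+1) = false.
  by apply/negbTE; rewrite -val_eqE /= -lt0n.
have ne' : (ord0 == ord_max :> 'I_p.+1) = false by rewrite eq_sym.
split.
- split; first by rewrite /= inE eq_sym ne.
  by move=> x y; rewrite !inE => /orP[]/eqP-> /orP[]/eqP->;
    rewrite /= /star_adj ?eqxx ?ne ?ne'.
    rewrite /= /star_adj ?eqxx ?ne ?ne'.
- move=> x; rewrite !inE negb_or => /andP[/negPf x0 xm].
  by exists ord0; rewrite ?inE ?eqxx // => z; rewrite /= /star_adj x0.
rewrite /=; congr [:: _; _].
  rewrite /pend (_ : [set x | _] = ~: [set ord0; ord_max]).
    by rewrite cardsCs setCK card_ord cards2 eq_sym ne /= subSS subn1.
  apply/setP=> x; rewrite !inE /= /star_adj eqxx.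
  by case: (x == ord0); rewrite ?andbT.
rewrite /pend (_ : [set x | _] = set0) ?cards0 //.
apply/setP=> x; rewrite !inE /= /star_adj ne addbF negb_or -andbA.
by case: (x == ord0); rewrite ?andbF.
Qed.

Lemma D_spine p q : 0 < p -> let s : seq (D p q) := [:: inl ord0; inl ord_max] in
  [/\ induced_path s, pendant_outside s & [seq pend [set x in s] y | y <- s] = [:: p.-1; q.-1]].
Proof.
move=> p0 s; have [is_ ps es] := star_spine p0.
have ms : ord_max \in [:: ord0; ord_max : star p] by rewrite !inE eqxx orbT.
split; first exact: attach_induced_path _ _ is_.
  exact: attach_pendant_outside ps ms.
apply: etrans (@attach_pends (star p) [:: ord0; ord_max] ord_max q.-1) _.
rewrite /=; case: es => -> ->.
have -> : (ord0 == ord_max :> 'I_p.+1) = false by apply/negbTE; rewrite eq_sym -val_eqE /= -lt0n.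
by rewrite eqxx mul0n mul1n addn0.
Qed.

Lemma caterpillar_D p q : 0 < p -> caterpillar [:: p.-1; q.-1] (D p q).
Proof. by move=> p0; have [h1 h2 h3] := D_spine q p0; exists [:: inl ord0; inl ord_max]. Qed.

(** The spine consists of the two centres of D(p - 1, q) and of the degree-one vertex
    to which the last edge is attached. *)
Lemma caterpillar_B p q : 2 < p -> 1 < q -> caterpillar [:: p - 2; q - 2; 1] (B p q).
Proof.
case: p => [|[|[|p]]] // _; case: q => [|[|q]] // _.
pose s2 : seq (D p.+2 q.+2) := [:: inl ord0; inl ord_max].
have [is_ ps es] : [/\ induced_path s2, pendant_outside s2 &
    [seq pend [set x in s2] y | y <- s2] = [:: p.+1; q.+1]].
  exact: (D_spine q.+2 (ltn0Sn p.+1)).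
have tD : is_tree (D p.+2 q.+2) by apply: caterpillar_tree is_ ps _.
pose x : D p.+2 q.+2 := inr ord0.
pose s : seq (D p.+2 q.+2) := rcons s2 x.
have xs2 : x \notin s2 by [].
have [us2 _] := is_.
have us : uniq s by rewrite rcons_uniq xs2 us2.
have ss : sorted (@adj _) s by rewrite /= eqxx.
have i3 : induced_path s by apply: tree_induced_path.
have p3 : pendant_outside s.
  apply: tree_pendant_outside => // y ys; have [|z zs e] := ps y.
    by apply: contra ys; rewrite mem_rcons inE => ->; rewrite orbT.
  by exists z; rewrite ?e // mem_rcons inE zs orbT.
have xs : x \in s by rewrite mem_rcons inE eqxx.
exists [seq inl y | y <- s]; split.
- exact: attach_induced_path _ _ i3.
- exact: attach_pendant_outside p3 xs.
rewrite attach_pends /= !subSS !subn0.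
have setS : [set y in s] = x |: [set y in s2].
  by apply/setP=> y; rewrite !inE orbA orbC.
have xS : x \notin [set y in s2] by rewrite inE.
case: es; rewrite !(pend_setU1 _ xS) -setS /= eqxx addn0 addn1 => -> [->].
have -> : pend [set y in s] x = 0.
  rewrite -(cards0 (D p.+2 q.+2)); apply: pend_eq => y; last by rewrite in_set0.
  case: y => [b|j] ys yx; last by [].
  by move: yx ys => /eqP->; rewrite !inE eqxx orbT.
by rewrite addn0.
Qed.

(** The spine consists of the first three vertices of P_4, so that the last vertex
    of P_4 hangs at its end; this is the shape [p - 2; q - 2; 1] with p and q
    exchanged. *)
Lemma caterpillar_B2 q : 1 < q -> caterpillar [:: q - 2; 0; 1] (B 2 q).
Proof.
move=> q1; pose o i (lt : i < 4) : path_graph 4 := Ordinal lt.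
pose s : seq (path_graph 4) := [:: ord0; o 1 isT; o 2 isT].
have is_ : induced_path s.
  by split=> // x y; rewrite !inE => /or3P[]/eqP-> /or3P[]/eqP->.
have ps : pendant_outside s.
  move=> [[|[|[|[|//]]]] lt] // _; exists (o 2 isT); rewrite ?inE //.
  by move=> [[|[|[|[|//]]]] lt'].
have es : [seq pend [set x in s] y | y <- s] = [:: 0; 0; 1].
  rewrite /= ; congr [:: _; _; _].
  - rewrite (pend_eq (E := set0)) ?cards0 // => -[[|[|[|[|//]]]] lt]; rewrite !inE //.
  - rewrite (pend_eq (E := set0)) ?cards0 // => -[[|[|[|[|//]]]] lt]; rewrite !inE //.
  rewrite (pend_eq (E := [set o 3 isT])) ?cards1 // => -[[|[|[|[|//]]]] lt]; rewrite !inE //.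
have vs : ord0 \in s by [].
have -> : B 2 q = @attach (path_graph 4) ord0 (q - 2) by [].
exists [seq inl y | y <- s]; split.
- exact: attach_induced_path _ _ is_.
- exact: attach_pendant_outside ps vs.
rewrite attach_pends /=; case: es => -> -> ->.
by rewrite mul1n addn0 add0n.
Qed.

Lemma caterpillar_Pab m a b : 0 < m -> caterpillar (dumbbell m a b) (Pab m a b).
Proof.
case: m => // m _; pose s : seq (path_graph m.+1) := enum 'I_m.+1.
have is_ : induced_path s.
  split=> [|x y _ _]; first exact: enum_uniq.
  by rewrite !index_enum_ord.
have ps : pendant_outside s by move=> x; rewrite mem_enum.
have m0 : ord0 \in s by rewrite mem_enum.
have m1 : (inl ord_max : attach (ord0 : path_graph m.+1) a) \in [seq inl x | x <- s].
  by rewrite map_f ?mem_enum.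
have is1 := attach_induced_path (ord0 : path_graph m.+1) a is_.
have ps1 := attach_pendant_outside (k := a) ps m0.
exists [seq inl x | x <- [seq inl x | x <- s]]; split.
- exact: attach_induced_path _ _ is1.
- exact: attach_pendant_outside ps1 m1.
rewrite attach_pends -map_comp.
rewrite (eq_map (g := fun y : path_graph m.+1 => (y == ord0) * a + (y == ord_max) * b)); last first.
  move=> y; rewrite /= attach_pend ?mem_enum // [X in X + _ + _](_ : _ = 0) //.
  rewrite /pend (_ : [set x | _] = set0) ?cards0 //.
  by apply/setP=> x; rewrite !inE mem_enum.
apply: (@eq_from_nth _ 0) => [|i].
  rewrite size_map size_enum_ord; case: m {s is_ ps m0 m1 is1 ps1} => //= m.
  by rewrite size_rcons size_nseq.
rewrite size_map size_enum_ord => lti.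
rewrite (nth_map ord0) ?size_enum_ord // -!val_eqE /= nth_enum_ord //.
case: m lti {s is_ ps m0 m1 is1 ps1} => [|m] /=; first by case: i; rewrite // !mul1n.
case: i => [|i] /=; first by rewrite mul1n addn0.
rewrite !ltnS eqSS mul0n add0n nth_rcons size_nseq nth_nseq => le.
by case: ltngtP le => // _ _; rewrite ?mul0n ?mul1n.
Qed.

(** * Extremality *)

Lemma giso_sym G H : giso G H -> giso H G.
Proof.
case=> f [[g fK gK] adjf]; exists g; split; first by exists f.
by move=> x y; rewrite -adjf !gK.
Qed.

Lemma giso_le_F G H : giso G H -> F G <= F H.
Proof.
case=> f [bf adjf]; have injf := bij_inj bf.
rewrite /F; have inji : injective (fun A : {set G} => f @: A) by exact: imset_inj.
rewrite -(card_imset (mem (subtrees G)) inji); apply: subset_leq_card.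
apply/subsetP=> _ /imsetP[A sA ->]; move: sA; rewrite !inE => /andP[/set0Pn[x0 x0A] cA].
apply/andP; split; first by apply/set0Pn; exists (f x0); rewrite imset_f.
apply/connected_setP=> B sB /set0Pn[b bB] neB.
have [|||x [y []]] := connected_setP A cA (A :&: f @^-1: B).
- exact: subsetIl.
- have /imsetP[a aA eb] := subsetP sB b bB; apply/set0Pn; exists a.
  by rewrite !inE aA -eb.
- apply: contraNneq neB => eA; rewrite eqEsubset sB; apply/subsetP=> _ /imsetP[a aA ->].
  by move: aA; rewrite -eA !inE => /andP[].
rewrite !inE => /andP[xA fx] /andP[nfy yA] xy; exists (f x), (f y).
rewrite yA andTb in nfy; split=> //; last by rewrite adjf.
by rewrite inE imset_f ?andbT.
Qed.

Lemma giso_F G H : giso G H -> F G = F H.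
Proof.
by move=> iso; apply/eqP; rewrite eqn_leq !giso_le_F //; apply: giso_sym.
Qed.

(** The converse direction of the equivalence holds because isomorphic graphs have
    the same number of subtrees. *)
Lemma precisely_maximizes_by (P : sgraph -> Prop) G : P G ->
  (forall T, P T -> F T <= F G /\ (F T = F G -> giso T G)) -> precisely_maximizes P G.
Proof.
move=> PG maxG T PT; have [le eq] := maxG T PT; split=> [maxT|/giso_F-> T' /maxG[]//].
by apply: eq; apply/eqP; rewrite eqn_leq le maxT.
Qed.

Lemma precisely_minimizes_by (P : sgraph -> Prop) G : P G ->
  (forall T, P T -> F G <= F T /\ (F T = F G -> giso T G)) -> precisely_minimizes P G.
Proof.
move=> PG minG T PT; have [le eq] := minG T PT; split=> [minT|/giso_F-> T' /minG[]//].
by apply: eq; apply/eqP; rewrite eqn_leq le minT.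
Qed.

(** With the centre of the star and one of its leaves as the spine, a star is a
    degenerate double star. *)
Lemma star_caterpillar (G : sgraph) (V : {set G}) : is_tree G -> bipartition V ->
  #|V| = 1 -> 0 < #|~: V| -> caterpillar [:: 0; #|~: V|.-1] G.
Proof.
move=> tG bV V1 q0; have cT := tree_connected_setT tG.
have [u uV] : exists u, u \in V by apply/card_gt0P; rewrite V1.
have onlyu z : z \in V -> z = u by move=> zV; apply: (card1_eq V1).
have [|v _ uv] := connected_nbr cT (in_setT u).
  apply/eqP=> eT; have /card_gt0P[z] := q0; have := in_setT z.
  by rewrite eT !inE => /eqP->; rewrite uV.
have vV : v \notin V by rewrite (nbr_side bV uv) uV.
have [C [D [eT br cC cD]]] := tree_bridge tG cT (in_setT u) (in_setT v) uv.
have [dCD uC vD _ _] := br.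
have uCV : C :&: V = [set u].
  apply/setP=> z; rewrite !inE; apply/andP/eqP=> [[_ /onlyu]//|->]; by rewrite uC.
have eD : D = [set v].
  apply/eqP/negPn/negP=> neD; have [w wD vw] := connected_nbr cD vD neD.
  have wV : w \in V by rewrite (nbr_side bV vw).
  by have := disjointFr dCD uC; rewrite -(onlyu w wV) wD.
have := double_star_caterpillar tG bV br (esym eT) cC cD uV vV.
rewrite V1; apply; first by rewrite uCV cards1.
rewrite eD (_ : [set v] :\: V = [set v]) ?cards1 //.
by apply/setDidPl; rewrite disjoints1.
Qed.

Lemma exp2_sub2 p : 1 < p -> 2 ^ p = 4 * 2 ^ (p - 2).
Proof. by move=> p1; rewrite -[4]/(2 ^ 2) -expnD subnKC. Qed.

Lemma lopsided_scale f X Y n :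
  16 * f + 16 <= 3 * (4 * X * (4 * Y)) + 12 * (4 * Y) + 4 * (4 * X) + 16 * n ->
  f + 1 <= 3 * (X * Y) + 3 * Y + X + n /\
  (f + 1 = 3 * (X * Y) + 3 * Y + X + n ->
   16 * f + 16 = 3 * (4 * X * (4 * Y)) + 12 * (4 * Y) + 4 * (4 * X) + 16 * n).
Proof. by move=> h; split; lia. Qed.

(** The bounds on F + 1 in the last two cases are the values of F + 1 for the
    caterpillars named in them. *)
Lemma double_star_or_lopsided T n p q : bip_tree n p q T -> p + q = n -> 1 < p -> 1 < q ->
  let X := 2 ^ (p - 2) in let Y := 2 ^ (q - 2) in
  [\/ caterpillar [:: p.-1; q.-1] T,
    [/\ 2 < p, F T + 1 <= 3 * (X * Y) + 3 * Y + X + n &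
    F T + 1 = 3 * (X * Y) + 3 * Y + X + n -> caterpillar [:: p - 2; q - 2; 1] T]
  | [/\ 2 < q, F T + 1 <= 3 * (Y * X) + 3 * X + Y + n &
    F T + 1 = 3 * (Y * X) + 3 * X + Y + n -> caterpillar [:: q - 2; p - 2; 1] T]].
Proof.
case=> _ tT [V [cV cV' bV]] hn p1 q1 X Y.
case: (second_bound tT bV cV cV' p1 q1) => [cat|[p2 [le eq]]|[q2 [le eq]]].
- exact: Or31.
- rewrite hn (exp2_sub2 p1) (exp2_sub2 q1) in le eq.
  by have [le' eq'] := lopsided_scale le; apply: Or32; split=> // /eq'.
rewrite (addnC q p) hn (exp2_sub2 p1) (exp2_sub2 q1) in le eq.
by have [le' eq'] := lopsided_scale le; apply: Or33; split=> // /eq'.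
Qed.

Lemma F_D_eq p q : 0 < p -> 0 < q ->
  F (D p q) = 2 ^ (p + q - 2) + 2 ^ (p - 1) + 2 ^ (q - 1) + (p + q) - 2.
Proof.
case: p q => [|p] [|q] // _ _; rewrite (caterpillar_subtrees (caterpillar_D _ _)) //=.
by rewrite addnS addSn !subSS !subn0 expnD; lia.
Qed.

Lemma F_B_eq p q : 2 < p -> 1 < q ->
  F (B p q) + 1 = 3 * (2 ^ (p - 2) * 2 ^ (q - 2)) + 3 * 2 ^ (q - 2) + 2 ^ (p - 2) + (p + q).
Proof.
move=> p2 q1; rewrite (caterpillar_subtrees (caterpillar_B p2 q1)) /=.
move: p2 q1; case: p => [|[|p]] // _; case: q => [|[|q]] // _.
by rewrite !subSS !subn0; lia.
Qed.

Lemma F_B2_eq q : 1 < q -> F (B 2 q) = 2 ^ q + q + 4.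
Proof.
move=> q1; rewrite (caterpillar_subtrees (caterpillar_B2 q1)) /= (exp2_sub2 q1).
by move: q1; case: q => [|[|q]] // _; rewrite !subSS !subn0; lia.
Qed.

Lemma sumn_dumbbell m a b : sumn (dumbbell m a b) = a + b.
Proof.
by case: m => [|[|m]] //=; rewrite ?addn0 // -cats1 sumn_cat sumn_nseq /= addn0.
Qed.

Lemma size_dumbbell m a b : 0 < m -> size (dumbbell m a b) = m.
Proof. by case: m => [|[|m]] //= _; rewrite size_rcons size_nseq. Qed.

Lemma infix_dumbbell m a b :
  infix_sum (dumbbell m.+1 a b) =
    2 ^ (a + b) + m * (2 ^ a + 2 ^ b) + 'C(m, 2).
Proof.
case: m => [|m]; first by rewrite /= bin0n !addn0 muln1.
have pre j : prefix_sum (rcons (nseq j 0) b) = j + 2 ^ b.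
  by elim: j => [|j IHj] /=; rewrite ?IHj; lia.
have inf j : infix_sum (rcons (nseq j 0) b) = j.+1 * 2 ^ b + 'C(j.+1, 2).
  elim: j => [|j IHj]; first by rewrite (_ : 'C(1, 2) = 0) //=; lia.
  rewrite [rcons _ _]/= [infix_sum _]/= IHj pre [in RHS]binS bin1; lia.
rewrite [dumbbell _ _ _]/= [infix_sum _]/= inf pre expnD; lia.
Qed.

Lemma F_dumbbell G m a b : caterpillar (dumbbell m.+1 a b) G ->
  F G = m * (2 ^ a + 2 ^ b) + 'C(m, 2) + 2 ^ (a + b) + (a + b).
Proof.
move=> cat; rewrite (caterpillar_subtrees cat) infix_dumbbell sumn_dumbbell.
by rewrite addnC; congr (_ + _); rewrite -addnA addnC.
Qed.

Lemma odd_dumbbell p a b : 0 < p ->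
  \sum_(i < 2 * p - 1) (if odd i then 1 else nth 0 (dumbbell (2 * p - 1) a b) i)
    = p.-1 + (a + b).
Proof.
case: p => // p _; have -> : 2 * p.+1 - 1 = p.*2.+1 by lia.
case: p => [|p]; first by rewrite big_ord_recl big_ord0 /= addn0.
pose f i := if odd i then 1 else nth 0 (dumbbell p.*2.+3 a b) i.
rewrite -(big_mkord xpredT f) big_nat_recl // big_nat_recr //= {1 3}/f /=.
rewrite odd_double /= nth_rcons size_nseq ltnn eqxx.
have -> : \sum_(0 <= i < p.*2.+1) f i.+1 = \sum_(0 <= i < p.*2.+1) (~~ odd i : nat).
  apply: eq_big_nat => i /andP[_ lti]; rewrite /f -[nth _ _ _]/(nth 0 (rcons (nseq p.*2.+1 0) b) i).
  rewrite nth_rcons size_nseq nth_nseq lti /=.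
  by case: (odd i).
suff -> : \sum_(0 <= i < p.*2.+1) (~~ odd i : nat) = p.+1 by lia.
elim: p {f} => [|p IHp]; first by rewrite big_nat1.
by rewrite doubleS big_nat_recr // big_nat_recr //= IHp odd_double /=; lia.
Qed.

Lemma bip_tree_D n p q : 0 < p -> 0 < q -> p + q = n -> bip_tree n p q (D p q).
Proof.
move=> p0 q0 hn; apply: (caterpillar_bip_tree _ (caterpillar_D q p0)) => //=; first lia.
by left; rewrite !big_ord_recl big_ord0 /=; lia.
Qed.

Lemma bip_tree_B n p q : 1 < p -> 1 < q -> p + q = n -> bip_tree n p q (B p q).
Proof.
move=> p1 q1 hn; have [p2|p2] := ltnP 2 p.
  apply: (caterpillar_bip_tree _ (caterpillar_B p2 q1)) => //=; first lia.
  by left; rewrite !big_ord_recl big_ord0 /=; lia.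
have ep : p = 2 by lia.
rewrite ep; apply: (caterpillar_bip_tree _ (caterpillar_B2 q1)) => //=; try lia.
by right; rewrite !big_ord_recl big_ord0 /=; lia.
Qed.

Lemma bip_tree_Pab n p q a b : 0 < p -> p + q = n -> a + b = q - p + 1 -> p <= q ->
  bip_tree n p q (Pab (2 * p - 1) a b).
Proof.
move=> p0 hn hab le_pq; have m0 : 0 < 2 * p - 1 by lia.
apply: (caterpillar_bip_tree _ (caterpillar_Pab a b m0)) => //.
- by case: (2 * p - 1) => [|[]].
- by rewrite size_dumbbell // sumn_dumbbell; lia.
by right; rewrite size_dumbbell // odd_dumbbell //; lia.
Qed.

Lemma exp_sub2_gt1 p : 2 < p -> 1 < 2 ^ (p - 2).
Proof. by move=> p2; rewrite -{1}(expn0 2) ltn_exp2l // subn_gt0. Qed.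

Lemma F_D_exp p q : 1 < p -> 1 < q -> F (D p q) + 2 =
  4 * (2 ^ (p - 2) * 2 ^ (q - 2)) + 2 * 2 ^ (p - 2) + 2 * 2 ^ (q - 2) + (p + q).
Proof.
case: p => [|[|p]] // _; case: q => [|[|q]] // _.
rewrite F_D_eq // (_ : p.+2 + q.+2 - 2 = 2 + (p + q)); last by lia.
by rewrite !subSS !subn0 !expnD !expnS; lia.
Qed.

(** With X = 2^(p-2) and Y = 2^(q-2), this says that the second largest value is
    below that of D(p, q). *)
Lemma lopsided_lt_max f d X Y n : 1 < X -> f + 1 <= 3 * (X * Y) + 3 * Y + X + n ->
  d + 2 = 4 * (X * Y) + 2 * X + 2 * Y + n -> f < d.
Proof. by move=> /leq_exists[x ->]; rewrite mulnDl; lia. Qed.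

Lemma D_maximum n p q T : 0 < p -> p <= q -> p + q = n -> bip_tree n p q T ->
  (F T < F (D p q)) \/ giso T (D p q).
Proof.
move=> p0 le_pq hn bT; have catD := caterpillar_D q p0.
have [p1|p1] := ltnP 1 p; last first.
  right; apply: caterpillar_giso catD => //; have ep : p = 1 by lia.
  case: bT => _ tT [V [cV cV' bV]]; rewrite ep -cV'.
  by apply: (star_caterpillar tT bV); rewrite ?cV ?cV' ?ep // (leq_trans p0).
have q1 : 1 < q by apply: leq_trans le_pq.
have eD := F_D_exp p1 q1; rewrite hn in eD.
have [cat|[p2 le _]|[q2 le _]] := double_star_or_lopsided bT hn p1 q1.
- by right; apply: caterpillar_giso cat catD.
- by left; apply: lopsided_lt_max (exp_sub2_gt1 p2) le eD.
left; apply: lopsided_lt_max (exp_sub2_gt1 q2) le _; rewrite eD mulnC; lia.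
Qed.

(** With X = 2^(p-2) and Y = 2^(q-2), this says that B(q, p) has at most as many
    subtrees as B(p, q) when p <= q, with equality only for p = q. *)
Lemma lopsided_swap f g X Y n : X <= Y -> f + 1 <= 3 * (Y * X) + 3 * X + Y + n ->
  g + 1 = 3 * (X * Y) + 3 * Y + X + n ->
  f <= g /\ (f = g -> X = Y /\ f + 1 = 3 * (Y * X) + 3 * X + Y + n).
Proof. by rewrite (mulnC Y X); set Z := X * Y; clearbody Z; lia. Qed.

Lemma B_second_maximum n p q T : 1 < p -> p <= q -> p + q = n -> bip_tree n p q T ->
  ~ giso T (D p q) -> F T <= F (B p q) /\ (F T = F (B p q) -> giso T (B p q)).
Proof.
move=> p1 le_pq hn bT nD; have q1 : 1 < q by apply: leq_trans le_pq.
have p0 := ltnW p1.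
have [cat|[p2 le eq]|[q2 le eq]] := double_star_or_lopsided bT hn p1 q1.
- by case: nD; apply: caterpillar_giso cat (caterpillar_D q p0).
- have eB := F_B_eq p2 q1; rewrite hn in eB; rewrite -(leq_add2r 1) eB; split=> // e.
  by apply: (caterpillar_giso _ _ (caterpillar_B p2 q1)) => //; apply: eq; rewrite e.
have [p2|p2] := ltnP 2 p.
  have eB := F_B_eq p2 q1; rewrite hn in eB.
  have le_XY : 2 ^ (p - 2) <= 2 ^ (q - 2) by rewrite leq_exp2l // leq_sub2r.
  have [le1 eq1] := lopsided_swap le_XY le eB; split=> // /eq1[/eqP eXY /eq cat].
  have epq : p = q.
    by move: eXY; rewrite eqn_exp2l // => /eqP e; rewrite -(subnK p1) e subnK.
  by apply: (caterpillar_giso _ _ (caterpillar_B p2 q1)) => //; move: cat; rewrite epq.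
have ep : p = 2 by apply/eqP; rewrite eqn_leq p2.
have eB := F_B2_eq q1; rewrite (exp2_sub2 q1) in eB.
rewrite ep subnn -hn ep in le eq *.
have {}eB : F (B 2 q) + 1 = 3 * (2 ^ (q - 2) * 2 ^ 0) + 3 * 2 ^ 0 + 2 ^ (q - 2) + (2 + q).
  by rewrite eB; lia.
rewrite -(leq_add2r 1) eB; split=> // e.
by apply: (caterpillar_giso _ _ (caterpillar_B2 q1)) => //; apply: eq; rewrite e.
Qed.

Lemma B_not_D p q : 1 < p -> p <= q -> (p, q) <> (2, 2) -> ~ giso (B p q) (D p q).
Proof.
move=> p1 le_pq npq /giso_F; have q1 : 1 < q by apply: leq_trans le_pq.
have eD := F_D_exp p1 q1; have [p2|p2] := ltnP 2 p.
  move=> e; suff : F (B p q) < F (D p q) by rewrite e ltnn.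
  by apply: lopsided_lt_max (exp_sub2_gt1 p2) _ eD; rewrite F_B_eq.
have ep : p = 2 by apply/eqP; rewrite eqn_leq p2.
have q2 : 2 < q by rewrite ltn_neqAle q1 andbT; apply/eqP=> eq; apply: npq; rewrite ep -eq.
have := exp_sub2_gt1 q2; move: eD; rewrite ep F_B2_eq // (exp2_sub2 q1) subnn expn0; lia.
Qed.

Lemma Pab_minimum n p q T : 0 < p -> p <= q -> p + q = n -> bip_tree n p q T ->
  let k := q - p + 1 in let G := Pab (2 * p - 1) k./2 (uphalf k) in
  F G <= F T /\ (F T = F G -> giso T G).
Proof.
move=> p0 le_pq hn [_ tT [V [cV cV' bV]]] k G.
have m0 : 0 < 2 * p - 1 by lia.
have catG := caterpillar_Pab k./2 (uphalf k) m0.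
have [le eq] := min_caterpillar tT bV cV cV' p0 le_pq.
have eG : F G = k + min_weight (2 * p - 1) k.
  move: catG; rewrite -{1}(prednK m0) => /F_dumbbell ->; rewrite /min_weight /=.
  have -> : k./2 + uphalf k = k by rewrite uphalf_half addnCA addnn odd_double_half.
  set Z := _ * (_ + _); set W := 'C(_, _); set U := 2 ^ k; clearbody Z W U; lia.
rewrite eG; split=> // /eq cat; apply: caterpillar_giso cat catG.
by case: (2 * p - 1) => [|[]].
Qed.

Theorem theorem1p3 (n p q : nat) (hn : 2 <= n) (hp : 1 <= p) (hpq : p <= q)
    (hpqn : p + q = n) :
  [/\ [/\ bip_tree n p q (D p q),
          F (D p q) = 2 ^ (n - 2) + 2 ^ (p - 1) + 2 ^ (q - 1) + n - 2
        & precisely_maximizes (bip_tree n p q) (D p q)],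
      2 <= p ->
      [/\ bip_tree n p q (B p q) /\ ((p, q) <> (2, 2) -> ~ giso (B p q) (D p q)),
          F (B p q) =
            (if 2 < p then 3 * 2 ^ (n - 4) + 3 * 2 ^ (q - 2) + 2 ^ (p - 2) + n - 1
             else 2 ^ (n - 2) + n + 2)
        & precisely_maximizes
            (fun T => bip_tree n p q T /\ ~ giso T (D p q)) (B p q)]
    & [/\ bip_tree n p q
            (Pab (2 * p - 1) (n - 2 * p + 1)./2 (uphalf (n - 2 * p + 1))),
          F (Pab (2 * p - 1) (n - 2 * p + 1)./2 (uphalf (n - 2 * p + 1))) =
            (2 * p - 2) * (2 ^ (n - 2 * p + 1)./2 + 2 ^ uphalf (n - 2 * p + 1))
            + 'C(2 * p - 2, 2) + 2 ^ (n - 2 * p + 1) + (n - 2 * p + 1)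
        & precisely_minimizes (bip_tree n p q)
            (Pab (2 * p - 1) (n - 2 * p + 1)./2 (uphalf (n - 2 * p + 1)))]].
Proof.
have q0 : 0 < q by apply: leq_trans hpq.
split.
- have bD := bip_tree_D hp q0 hpqn; split=> //.
    by rewrite F_D_eq // hpqn.
  apply: precisely_maximizes_by => // T bT.
  have [lt|iso] := D_maximum hp hpq hpqn bT; last by rewrite (giso_F iso).
  by split; [exact: ltnW|move=> e; rewrite e ltnn in lt].
- move=> p1; have q1 : 1 < q by apply: leq_trans hpq.
  have bB := bip_tree_B p1 q1 hpqn; have nBD := B_not_D p1 hpq.
  split=> //.
    have [p2|p2] := ltnP 2 p.
      rewrite -[LHS](addnK 1) F_B_eq // hpqn -expnD (_ : p - 2 + (q - 2) = n - 4) //; lia.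
    have ep : p = 2 by apply/eqP; rewrite eqn_leq p2.
    by rewrite -hpqn ep F_B2_eq // addKn; lia.
  (* The second class is empty for p = q = 2, as all trees are then double stars. *)
  have [[ep eq]|npq] : (p, q) = (2, 2) \/ (p, q) <> (2, 2).
      by case: (eqVneq (p, q) (2, 2)) => [->|/eqP]; [left|right].
    move=> T [bT []]; rewrite ep eq in bT *.
    have e4 : 2 + 2 = n by rewrite -hpqn ep eq.
    have [cat|[//]|[//]] := double_star_or_lopsided bT e4 isT isT.
    by apply: caterpillar_giso cat (caterpillar_D 2 (isT : 0 < 2)).
  apply: precisely_maximizes_by => [|T [bT nT]]; first by split=> //; apply: nBD.
  exact: B_second_maximum p1 hpq hpqn bT nT.
have ek : n - 2 * p + 1 = q - p + 1 by lia.
have hk : (q - p + 1)./2 + uphalf (q - p + 1) = q - p + 1.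
  by rewrite uphalf_half addnCA addnn odd_double_half.
have m0 : 0 < 2 * p - 1 by lia.
rewrite ek; have bP := bip_tree_Pab hp hpqn hk hpq; split=> //.
  have := caterpillar_Pab (q - p + 1)./2 (uphalf (q - p + 1)) m0.
  rewrite -{1}(prednK m0) => /F_dumbbell ->.
  by rewrite hk (_ : (2 * p - 1).-1 = 2 * p - 2) // -subn1 -subnDA.
by apply: precisely_minimizes_by => // T bT; apply: Pab_minimum hpqn bT.
Qed.
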